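(* Let $\varphi\in L^2(\mathbb{R}^2)$ satisfy $\operatorname{supp}(\varphi)\subseteq[N_1,M_1]\times[N_2,M_2]$, with $\{\varphi(\cdot-\boldsymbol{k}):\boldsymbol{k}\in\mathbb{Z}^2\}$ linearly independent, and let $f\in V(\varphi,\mathbb{Z}^2)$ be an arbitrary target function with $\operatorname{supp}(f)\subseteq[a_1,b_1]\times[a_2,b_2]$. Let $\boldsymbol{p}=(\cos\theta,\sin\theta)$ be a direction vector such that $\mathcal{R}_{\boldsymbol{p}}\varphi$ is continuous. Let $$E=\{\boldsymbol{k}_1,\dots,\boldsymbol{k}_{\#E}\}=\big([\lceil a_1-M_1\rceil,\lfloor b_1-N_1\rfloor]\times[\lceil a_2-M_2\rceil,\lfloor b_2-N_2\rfloor]\big)\cap\mathbb{Z}^2,$$ and write $\widehat{\mathcal{R}_{\boldsymbol{p}}\varphi}=u+iv$ with $u,v$ the (real-valued) real and imaginary parts. Suppose that (i) or (ii) below holds, and that (iii) holds: (i) $u\not\equiv0$ and the sign of $u$ is unchanged, i.e. either $u(\xi)\ge0$ for all $\xi\in\mathbb{R}$ or $u(\xi)\le0$ for all $\xi\in\mathbb{R}$; (ii) $v\not\equiv0$ and the sign of $v$ is unchanged, i.e. either $v(\xi)\ge0$ for all $\xi\in\mathbb{R}$ or $v(\xi)\le0$ for all $\xi\in\mathbb{R}$; (iii) if $\#E>1$ then $\boldsymbol{p}\boldsymbol{k}_l\ne\boldsymbol{p}\boldsymbol{k}_n$ for any $l\neq n$. Then the matrix $A_{\varphi,\boldsymbol{p},X_{\boldsymbol{p}}}=\big(\mathcal{R}_{\boldsymbol{p}}\varphi(\boldsymbol{p}\boldsymbol{k}_j-\boldsymbol{p}\boldsymbol{k}_n)\big)_{j,n=1}^{\#E}$,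 where $X_{\boldsymbol{p}}=\{\boldsymbol{p}\boldsymbol{k}_1,\dots,\boldsymbol{p}\boldsymbol{k}_{\#E}\}$, is invertible. Consequently, $f$ can be determined uniquely by its single-angle Radon samples (with respect to $\boldsymbol{p}$) at $X_{\boldsymbol{p}}$.
   Context: Vectors in $\mathbb{R}^2$ are columns; a direction vector $\boldsymbol{p}=(\cos\theta,\sin\theta)$ is a row vector, so $\boldsymbol{p}\boldsymbol{k}=k_1\cos\theta+k_2\sin\theta$. $\mathcal{R}_{\boldsymbol{p}}f(t)=\int_{-\infty}^{\infty}f(t\cos\theta-s\sin\theta,\,t\sin\theta+s\cos\theta)\,ds$. Continuity of $\mathcal{R}_{\boldsymbol{p}}\varphi$ is understood after modification on a null set, and samples are values of the continuous representative. The Fourier transform is $\widehat{g}(\gamma)=\int_{\mathbb{R}^d}g(\boldsymbol{x})e^{-i\boldsymbol{x}\cdot\gamma}d\boldsymbol{x}$. $V(\varphi,\mathbb{Z}^2)=\{\sum_{\boldsymbol{k}\in\mathbb{Z}^2}c_{\boldsymbol{k}}\varphi(\cdot-\boldsymbol{k}):\sum_{\boldsymbol{k}}|c_{\boldsymbol{k}}|^2<\infty\}$. Standing convention: a target function $f\in V(\varphi,\mathbb{Z}^2)$ with $\operatorname{supp}(f)\subseteq[a_1,b_1]\times[a_2,b_2]$ is one expressed as $f=\sum_{\boldsymbol{k}\in E}c_{\boldsymbol{k}}\varphi(\cdot-\boldsymbol{k})$ with $c_{\boldsymbol{k}}\in\mathbb{C}$. ''$f$ can be determined uniquely by its single-angle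 Radon samples at $X$'' means that $f$ is the only function $h$ of the form $\sum_{\boldsymbol{k}\in E}d_{\boldsymbol{k}}\varphi(\cdot-\boldsymbol{k})$, $d_{\boldsymbol{k}}\in\mathbb{C}$, with $\mathcal{R}_{\boldsymbol{p}}h(x)=\mathcal{R}_{\boldsymbol{p}}f(x)$ for all $x\in X$. *)

(* Defs.v *)
From HB Require Import structures.
From mathcomp Require Import all_boot all_order all_algebra.
From mathcomp Require Import complex.
From mathcomp Require Import all_classical all_reals all_analysis.

Set Implicit Arguments.
Unset Strict Implicit.
Unset Printing Implicit Defensive.

Import Order.TTheory GRing.Theory Num.Theory.
Import numFieldNormedType.Exports.

Local Open Scope classical_set_scope.
Local Open Scope ring_scope.
Local Open Scope complex_scope.

Section Defs.
Context {R : realType}.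

(* Points of R^2 carry the Borel sigma-algebra; every class of L^2 has a Borel
   representative, and functions are compared up to null sets below. *)
Local Notation plane := (measurableTypeR R * measurableTypeR R)%type.

Definition leb2 : set plane -> \bar R :=
  ((@lebesgue_measure R) \x (@lebesgue_measure R))%E.

Definition shift2 (x : R * R) (k : int * int) : R * R :=
  (x.1 - k.1%:~R, x.2 - k.2%:~R).

Definition box (a b : R * R) : set (R * R) := `[a.1, b.1] `*` `[a.2, b.2].

Definition aeq2 (f g : R * R -> R[i]) : Prop :=
  {ae leb2, forall x, f x = g x}.

Definition sqnorm (z : R[i]) : R := complex.Re z ^+ 2 + complex.Im z ^+ 2.

Definition L2 (f : R * R -> R[i]) : Prop :=
  [/\ measurable_fun [set: plane] (fun x => complex.Re (f x)),
      measurable_fun [set: plane] (fun x => complex.Im (f x)) &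
      (\int[leb2]_x (sqnorm (f x))%:E < +oo)%E].

(* Support of a function defined up to null sets: the complement of the union
   of all open sets on which it vanishes almost everywhere. *)
Definition supp (f : R * R -> R[i]) : set (R * R) :=
  [set x | forall U : set (R * R), open U -> U x ->
     ~ {ae leb2, forall y, U y -> f y = 0}].

(* Finite linear independence of the integer translates, as elements of L^2. *)
Definition translates_independent (phi : R * R -> R[i]) : Prop :=
  forall (F : set (int * int)) (c : int * int -> R[i]), finite_set F ->
    aeq2 (fun x => \sum_(k \in F) c k * phi (shift2 x k)) (fun=> 0) ->
    forall k, F k -> c k = 0.

Definition square (n : nat) : set (int * int) :=
  [set k | `|k.1| <= n%:Z /\ `|k.2| <= n%:Z].

(* The shift-invariant space V(phi, Z^2): the series converges in L^2. *)
Definition in_V (phi f : R * R -> R[i]) : Prop :=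
  L2 f /\
  exists c : int * int -> R[i],
    (\esum_(k in [set: int * int]) (sqnorm (c k))%:E < +oo)%E /\
    (fun n => \int[leb2]_x
       (sqnorm (f x - \sum_(k \in square n) c k * phi (shift2 x k)))%:E)%E
      @ \oo --> 0%E.

(* Elements of L^2 of the form sum_(k in E) d_k phi(. - k). *)
Definition span_on (phi : R * R -> R[i]) (E : set (int * int))
    (h : R * R -> R[i]) : Prop :=
  L2 h /\
  exists d : int * int -> R[i],
    aeq2 h (fun x => \sum_(k \in E) d k * phi (shift2 x k)).

Definition index_set (N M a b : R * R) : set (int * int) :=
  [set k | (Num.ceil (a.1 - M.1) <= k.1 <= Num.floor (b.1 - N.1)) &&
           (Num.ceil (a.2 - M.2) <= k.2 <= Num.floor (b.2 - N.2))].

Definition target (phi : R * R -> R[i]) (N M a b : R * R)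
    (f : R * R -> R[i]) : Prop :=
  [/\ in_V phi f, supp f `<=` box a b & span_on phi (index_set N M a b) f].

Definition cintegral (g : R -> R[i]) : R[i] :=
  Rintegral (@lebesgue_measure R) setT (fun x => complex.Re (g x)) +i*
  Rintegral (@lebesgue_measure R) setT (fun x => complex.Im (g x)).

Definition expi (y : R) : R[i] := cos y +i* sin y.

Definition fourier (g : R -> R[i]) (xi : R) : R[i] :=
  cintegral (fun x => g x * expi (- (x * xi))).

Definition radon (theta : R) (f : R * R -> R[i]) (t : R) : R[i] :=
  cintegral (fun s => f (t * cos theta - s * sin theta,
                         t * sin theta + s * cos theta)).

Definition pdot (theta : R) (k : int * int) : R :=
  k.1%:~R * cos theta + k.2%:~R * sin theta.

Definition crep_of (F g : R -> R[i]) : Prop :=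
  continuous (g : R -> R[i]^o) /\
  {ae (@lebesgue_measure R), forall t, F t = g t}.

(* [crep F] is the continuous representative of F; it is unique when it exists,
   and is 0 by convention otherwise. *)
Definition crep (F : R -> R[i]) : R -> R[i] :=
  xget (fun=> 0) [set g | crep_of F g].

Definition radon_continuous (theta : R) (phi : R * R -> R[i]) : Prop :=
  exists g, crep_of (radon theta phi) g.

Definition radon_sample (theta : R) (f : R * R -> R[i]) (x : R) : R[i] :=
  crep (radon theta f) x.

Definition sign_unchanged (u : R -> R) : Prop :=
  (forall xi, 0 <= u xi) \/ (forall xi, u xi <= 0).

Definition determined_uniquely (theta : R) (phi : R * R -> R[i])
    (E : set (int * int)) (X : set R) (f : R * R -> R[i]) : Prop :=
  forall h, span_on phi E h ->
    (forall x, X x -> radon_sample theta h x = radon_sample theta f x) ->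
    aeq2 h f.

Definition sample_matrix (theta : R) (phi : R * R -> R[i]) (n : nat)
    (k : 'I_n -> int * int) : 'M[R[i]]_n :=
  \matrix_(j, l) radon_sample theta phi (pdot theta (k j) - pdot theta (k l)).

End Defs.

(* Main.v *)
(* Let g be the continuous representative of the Radon transform of phi; it is
   integrable. If A c = 0, where A = (g(y_j - y_l)) and y_j = p k_j, put
   h(x) = sum_(j,l) conj(c_j) c_l g(x + y_j - y_l). Its Fourier transform is
   |P|^2 times that of g, with P(xi) = sum_l c_l exp(-i y_l xi), and h(0) = 0.
   Multiplying g by one of 1, -1, i, -i, we may assume that the real part U of
   the Fourier transform of g is nonnegative. Then |P|^2 U >= 0, while the
   Cesaro means of its integral are integrals of Re h against Fejer kernels and
   tend to 0 because h(0) = 0. Hence |P|^2 U = 0, so P vanishes on an interval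
   on which U does not, and c = 0 since the frequencies y_l are distinct.
   Uniqueness follows: the samples of sum_k d_k phi(. - k) are the entries of
   A d, by Fubini and the rotation invariance of the Lebesgue measure. *)
Require Import Defs.
From HB Require Import structures.
From mathcomp Require Import all_boot all_order all_algebra.
From mathcomp Require Import complex ring lra.
From mathcomp Require Import all_classical all_reals all_analysis.
From mathcomp Require Import measurable_realfun.

Import Order.TTheory GRing.Theory Num.Theory.
Import numFieldNormedType.Exports.

Local Open Scope classical_set_scope.
Local Open Scope ring_scope.
Local Open Scope complex_scope.

(** * Linear changes of variables *)

Lemma measurable_affine {R : realType} (al be : R) : measurable_fun setT
  ((fun x => al * x + be) : measurableTypeR R -> measurableTypeR R).
Proof. by apply: measurable_funD => //; exact: measurable_funM. Qed.

(** The left side is a measure in [A] that agrees with Lebesgue measure on half-open intervals, so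
    the uniqueness of Lebesgue measure settles all measurable sets. *)
Lemma scale_pushforward_affine_gt0 {R : realType} (al be : R) (A : set R) :
  0 < al -> measurable A ->
  (al%:E * pushforward lebesgue_measure
    ((fun x => al * x + be)%R : measurableTypeR R -> measurableTypeR R) A)%E
  = lebesgue_measure A.
Proof.
move=> a0 mA.
pose m := measure_function_pushforward__canonical__measure_function_Measure
  lebesgue_measure (measurable_affine al be).
rewrite [RHS](@lebesgue_measure_unique R (mscale (NngNum (ltW a0)) m))//.
move=> _ [[x y]] _ <-.
transitivity (al%:E * lebesgue_measure
  ((fun z => al * z + be)%R @^-1` `]x, y]%classic))%E => //.
have -> : (fun z => al * z + be) @^-1` `]x, y]%classic =
    `](x - be) / al, (y - be) / al]%classic.
  apply/seteqP; split => z /=; rewrite !in_itv/= ltr_pdivrMr// ler_pdivlMr//;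
  by rewrite ltrBlDr lerBrDr (mulrC z).
rewrite !lebesgue_measure_itv/= !lte_fin ltr_pM2r ?invr_gt0// ltrD2r.
case: ifPn => _; last by rewrite mule0.
rewrite -!EFinB -EFinM; congr (_%:E); field.
exact: lt0r_neq0.
Qed.

Lemma ge0_integral_affine_gt0 {R : realType} (al be : R) (f : R -> \bar R) :
  0 < al -> measurable_fun setT f -> (forall x, 0 <= f x)%E ->
  (\int[lebesgue_measure]_x f (al * x + be)%R =
   al^-1%:E * \int[lebesgue_measure]_x f x)%E.
Proof.
move=> al0 mf f0; have mh := measurable_affine al be.
have := @ge0_integral_pushforward _ _ _ _ _ _ mh lebesgue_measure setT f.
rewrite preimage_setT => <-//.
pose m := measure_function_pushforward__canonical__measure_function_Measure
  lebesgue_measure mh.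
rewrite [in RHS](eq_measure_integral (mscale (NngNum (ltW al0)) m)); last first.
  by move=> A mA _; exact/esym/scale_pushforward_affine_gt0.
by rewrite ge0_integral_mscale//= muleA -EFinM mulVf ?lt0r_neq0// mul1e.
Qed.

Lemma ge0_integral_opp {R : realType} (f : R -> \bar R) :
  measurable_fun setT f -> (forall x, 0 <= f x)%E ->
  (\int[lebesgue_measure]_x f (- x)%R = \int[lebesgue_measure]_x f x)%E.
Proof.
move=> mf f0.
have mh : measurable_fun setT (-%R : measurableTypeR R -> measurableTypeR R).
  exact: oppr_measurable.
have := @ge0_integral_pushforward _ _ _ _ _ _ mh lebesgue_measure setT f.
rewrite preimage_setT => <-//.
by apply: eq_measure_integral => A mA _; exact: lebesgue_measureN.
Qed.

(** A negative slope is brought back to a positive one by the reflection of the line at the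
    origin. *)
Lemma ge0_integral_affine {R : realType} (al be : R) (f : R -> \bar R) :
  al != 0 -> measurable_fun setT f -> (forall x, 0 <= f x)%E ->
  (\int[lebesgue_measure]_x f (al * x + be)%R =
   `|al|^-1%:E * \int[lebesgue_measure]_x f x)%E.
Proof.
move=> al0 mf f0; have [aN|a0|a0] := ltgtP al 0; last 1 first.
- by move: al0; rewrite a0 eqxx.
- rewrite (ltr0_norm aN) -ge0_integral_opp//; last first.
    exact: measurableT_comp mf (measurable_affine al be).
  under eq_integral do rewrite mulrN -mulNr.
  by rewrite ge0_integral_affine_gt0// oppr_gt0.
- by rewrite (gtr0_norm a0) ge0_integral_affine_gt0.
Qed.

Section plane_linear.
Context {R : realType}.
Local Notation plane := (measurableTypeR R * measurableTypeR R)%type.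
Local Notation mu := (@lebesgue_measure R).

Lemma measurable_linear2 (a b c d : R) : measurable_fun setT
  ((fun x => (a * x.1 + b * x.2, c * x.1 + d * x.2)) : plane -> plane).
Proof.
apply/measurable_fun_pairP; split; apply: measurable_funD => /=;
by apply: measurable_funM.
Qed.

Lemma measurable_pair_affine (p q : R) : measurable_fun setT
  ((fun x => (x, p + q * x)) : measurableTypeR R -> plane).
Proof.
apply/measurable_fun_pairP; split; first exact: measurable_id.
by apply: measurable_funD => //; exact: measurable_funM.
Qed.

(* An affine substitution in [v] reduces the map to a shear, and after an
   exchange of the integrals an affine substitution in [u] removes the shear. *)
Lemma ge0_integral_linear2 (a b c d : R) (F : plane -> \bar R) :
  b != 0 -> b * c - a * d != 0 ->
  measurable_fun setT F -> (forall x, 0 <= F x)%E ->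
  (\int[mu]_u \int[mu]_v F (a * u + b * v, c * u + d * v)%R =
   `|b * c - a * d|^-1%:E * \int[mu]_u \int[mu]_v F (u, v))%E.
Proof.
move=> b0 D0 mF F0.
have mS : measurable_fun setT ((fun z : plane =>
    (0 * z.1 + 1 * z.2, (b * c - a * d) / b * z.1 + d / b * z.2))
      : plane -> plane).
  exact: measurable_linear2.
have E u : (\int[mu]_v F (a * u + b * v, c * u + d * v)%R =
    `|b|^-1%:E * \int[mu]_x F (x, (b * c - a * d) / b * u + d / b * x)%R)%E.
  rewrite -(@ge0_integral_affine _ b (a * u)
    (fun x => F (x, (b * c - a * d) / b * u + d / b * x)%R))//.
    apply: eq_integral => v _; congr (F (_, _)); first by rewrite addrC.
    by field.
  by apply: measurableT_comp mF _; exact: measurable_pair_affine.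
under eq_integral do rewrite E.
have mF' : measurable_fun setT (fun z : plane =>
    F (z.2, (b * c - a * d) / b * z.1 + d / b * z.2)).
  have := measurableT_comp mF mS.
  by under eq_fun do rewrite /= mul0r mul1r add0r.
rewrite ge0_integralZl//; last first.
- by move=> u _; exact: integral_ge0.
- exact: (measurable_fun_fubini_tonelli_F _ mF').
rewrite (@fubini_tonelli _ _ _ _ _ mu mu _ mF')//=.
have E2 x : (\int[mu]_y F (x, (b * c - a * d) / b * y + d / b * x)%R =
    `|(b * c - a * d) / b|^-1%:E * \int[mu]_y F (x, y))%E.
  rewrite -(@ge0_integral_affine _ _ (d / b * x) (fun y => F (x, y)))//.
    by rewrite mulf_neq0// invr_eq0.
  exact: measurableT_comp mF (pair1_measurable x).
under eq_integral do rewrite E2.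
rewrite ge0_integralZl//; last first.
- by move=> u _; exact: integral_ge0.
- exact: (measurable_fun_fubini_tonelli_F _ mF).
rewrite muleA -EFinM; congr (_%:E * _)%E.
by rewrite normrM normfV invfM invrK mulrCA mulVf ?normr_eq0// mulr1.
Qed.

End plane_linear.

(** * Rotation invariance of planar Lebesgue measure *)

Section rotation.
Context {R : realType}.
Local Notation plane := (measurableTypeR R * measurableTypeR R)%type.
Local Notation mu := (@lebesgue_measure R).
Local Notation mu2 := (@lebesgue_measure R \x @lebesgue_measure R)%E.

Definition rot (theta : R) (x : plane) : plane :=
  (x.1 * cos theta - x.2 * sin theta, x.1 * sin theta + x.2 * cos theta).

Lemma measurable_rot theta : measurable_fun setT (rot theta).
Proof.
have := @measurable_linear2 R (cos theta) (- sin theta) (sin theta) (cos theta).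
congr (measurable_fun _ _); apply/funext => x; congr (_, _) => /=.
  by rewrite mulNr !(mulrC x.1) (mulrC x.2).
by rewrite !(mulrC x.1) (mulrC x.2).
Qed.

Lemma ge0_integral_rot theta (F : plane -> \bar R) :
  measurable_fun setT F -> (forall x, 0 <= F x)%E ->
  (\int[mu]_t \int[mu]_s F (rot theta (t, s)) = \int[leb2]_x F x)%E.
Proof.
move=> mF F0; rewrite [RHS](@fubini_tonelli1 _ _ _ _ _ mu mu F mF F0).
have mFr : measurable_fun setT (F \o rot theta).
  exact: measurableT_comp mF (measurable_rot theta).
have Fr0 x : (0 <= (F \o rot theta) x)%E by exact: F0.
(* The linear substitution needs a nonzero coefficient on the inner variable. It is [- sin theta] in
   general; when this vanishes, exchanging the integrals puts [cos theta] in its place. *)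
have [s0|s0] := eqVneq (sin theta) 0.
  have c2 : cos theta ^+ 2 = 1.
    by have := cos2Dsin2 theta; rewrite s0 expr0n addr0.
  rewrite (@fubini_tonelli _ _ _ _ _ mu mu _ mFr Fr0).
  have := @ge0_integral_linear2 R (- sin theta) (cos theta) (cos theta)
    (sin theta) F.
  rewrite s0 mulr0 subr0 -expr2 c2 normr1 invr1 mul1e => /(_ _ _ mF F0) <-.
  - apply: eq_integral => s _; apply: eq_integral => t _.
    rewrite /rot/= s0 !(mulrC (cos _)) !mulr0 !mul0r oppr0 mul0r.
    by rewrite addr0 add0r addr0 add0r.
  - by rewrite -sqrf_eq0 c2 oner_eq0.
  - by rewrite oner_eq0.
have := @ge0_integral_linear2 R (cos theta) (- sin theta) (sin theta)
  (cos theta) F.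
rewrite mulNr -!expr2 -opprD addrC cos2Dsin2 normrN normr1 invr1 mul1e.
move=> /(_ _ _ mF F0) <-.
- apply: eq_integral => s _; apply: eq_integral => t _.
  by rewrite /rot/= mulNr !(mulrC s) !(mulrC t).
- by rewrite oppr_eq0.
- by rewrite oppr_eq0 oner_eq0.
Qed.

Lemma leb2_rot theta (B : set plane) : measurable B ->
  leb2 (rot theta @^-1` B) = leb2 B.
Proof.
move=> mB.
have mrB : measurable (rot theta @^-1` B).
  by rewrite -[X in measurable X]setTI; exact: measurable_rot.
pose I := fun x : plane => (\1_B x : R)%:E.
have mI : measurable_fun setT I by exact/measurable_EFinP/measurable_indic.
have I0 x : (0 <= I x)%E by rewrite lee_fin.
have HI (C : set plane) : measurable C ->
    (\int[leb2]_x (\1_C x : R)%:E = leb2 C)%E.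
  by move=> mC; rewrite integral_indic// setIT.
rewrite -(HI _ mB) -(HI _ mrB) -[RHS](@ge0_integral_rot theta I)//.
rewrite [LHS](@fubini_tonelli1 _ _ _ _ _ mu mu)//.
exact/measurable_EFinP/measurable_indic.
Qed.

(** The rotated exceptional set is still null, so by Tonelli almost every line orthogonal to the
    direction meets it in a null set. This carries planar null sets over to Radon transforms. *)
Lemma ae_rot theta (P : plane -> Prop) : {ae leb2, forall x, P x} ->
  {ae mu, forall t, {ae mu, forall s, P (rot theta (t, s))}}.
Proof.
move=> [B [mB B0 PB]].
have mrB : measurable (rot theta @^-1` B).
  by rewrite -[X in measurable X]setTI; exact: measurable_rot.
have /ae_eq_integral_abs : (\int[mu]_(t in setT)
    `|mu (xsection (rot theta @^-1` B) t)| = 0)%E.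
  rewrite -[RHS]B0 -(leb2_rot theta _ mB); apply: eq_integral => t _.
  by rewrite gee0_abs.
move=> /(_ measurableT (measurable_fun_xsection _ mrB)).
apply: filterS => t /(_ I) /= Bt.
exists (xsection (rot theta @^-1` B) t); split => //.
  exact: measurable_xsection.
by move=> s /= /PB Bs; rewrite /xsection/= inE.
Qed.

Lemma integrable_rot theta (f : plane -> R) :
  mu2.-integrable setT (EFin \o f) ->
  mu2.-integrable setT (EFin \o (f \o rot theta)).
Proof.
move=> /integrableP[mf fi].
have mfr : measurable_fun setT (EFin \o (f \o rot theta)).
  exact: measurableT_comp mf (measurable_rot theta).
apply/integrable12ltyP => //.
have -> // := @ge0_integral_rot theta (fun x => `|(f x)%:E|)%E.
exact: measurableT_comp.
Qed.

End rotation.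
(** * Complex-valued integrals *)

Section complex_integral.
Context {R : realType}.
Implicit Types c z : R[i].

Lemma ReM c z : complex.Re (c * z) =
  complex.Re c * complex.Re z - complex.Im c * complex.Im z.
Proof. by case: c; case: z. Qed.

Lemma ImM c z : complex.Im (c * z) =
  complex.Re c * complex.Im z + complex.Im c * complex.Re z.
Proof. by case: c => a b; case: z => x y /=. Qed.

Lemma ReD c z : complex.Re (c + z) = complex.Re c + complex.Re z.
Proof. by case: c; case: z. Qed.

Lemma ImD c z : complex.Im (c + z) = complex.Im c + complex.Im z.
Proof. by case: c; case: z. Qed.

Definition cmeasurable {d} {T : measurableType d} (g : T -> R[i]) :=
  measurable_fun setT (fun x => complex.Re (g x)) /\
  measurable_fun setT (fun x => complex.Im (g x)).

Definition cintegrable {d} {T : measurableType d}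
    (mu : {measure set T -> \bar R}) (g : T -> R[i]) :=
  mu.-integrable setT (fun x => (complex.Re (g x))%:E) /\
  mu.-integrable setT (fun x => (complex.Im (g x))%:E).

Section general.
Context {d} {T : measurableType d} (mu : {measure set T -> \bar R}).
Implicit Types g h : T -> R[i].

Lemma cmeasurableZ c g : cmeasurable g -> cmeasurable (fun x => c * g x).
Proof.
move=> [mr mi]; split.
  under eq_fun do rewrite ReM.
  by apply: measurable_funB; exact: measurable_funM.
under eq_fun do rewrite ImM.
by apply: measurable_funD; exact: measurable_funM.
Qed.

Lemma cmeasurableD g h : cmeasurable g -> cmeasurable h ->
  cmeasurable (fun x => g x + h x).
Proof.
move=> [gr gi] [hr hi]; split.
  by under eq_fun do rewrite ReD; exact: measurable_funD.
by under eq_fun do rewrite ImD; exact: measurable_funD.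
Qed.

Lemma cmeasurable_sum (I : Type) (r : seq I) (g : I -> T -> R[i]) :
  (forall i, cmeasurable (g i)) -> cmeasurable (fun x => \sum_(i <- r) g i x).
Proof.
move=> mg; elim: r => [|i r IH].
  by split; under eq_fun do rewrite big_nil; exact: measurable_cst.
by under eq_fun do rewrite big_cons; exact: cmeasurableD.
Qed.

Lemma cintegrable_measurable g : cintegrable mu g -> cmeasurable g.
Proof.
by move=> [/measurable_int/measurable_EFinP ?
  /measurable_int/measurable_EFinP ?].
Qed.

Lemma cintegrableZ c g : cintegrable mu g -> cintegrable mu (fun x => c * g x).
Proof.
move=> [gr gi]; split.
  under eq_fun do rewrite ReM EFinB !EFinM.
  by apply: integrableB => //; exact: integrableZl.
under eq_fun do rewrite ImM EFinD !EFinM.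
by apply: integrableD => //; exact: integrableZl.
Qed.

Lemma cintegrableD g h : cintegrable mu g -> cintegrable mu h ->
  cintegrable mu (fun x => g x + h x).
Proof.
move=> [gr gi] [hr hi]; split.
  by under eq_fun do rewrite ReD EFinD; exact: integrableD.
by under eq_fun do rewrite ImD EFinD; exact: integrableD.
Qed.

Lemma cintegrable_sum (I : Type) (r : seq I) (g : I -> T -> R[i]) :
  (forall i, cintegrable mu (g i)) ->
  cintegrable mu (fun x => \sum_(i <- r) g i x).
Proof.
move=> mg; elim: r => [|i r IH].
  by split; under eq_fun do rewrite big_nil; exact: integrable0.
by under eq_fun do rewrite big_cons; exact: cintegrableD.
Qed.

End general.

Local Notation mu := (@lebesgue_measure R).
Implicit Types g h : R -> R[i].

Lemma cintegralZ c g : cintegrable mu g ->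
  cintegral (fun x => c * g x) = c * cintegral g.
Proof.
move=> [gr gi]; rewrite /cintegral.
under eq_Rintegral do rewrite ReM.
under [X in _ +i* X]eq_Rintegral do rewrite ImM.
have gr' (a : R) : mu.-integrable setT (fun x => (a * complex.Re (g x))%:E).
  by under eq_fun do rewrite EFinM; exact: integrableZl.
have gi' (a : R) : mu.-integrable setT (fun x => (a * complex.Im (g x))%:E).
  by under eq_fun do rewrite EFinM; exact: integrableZl.
rewrite (RintegralB measurableT (gr' _) (gi' _)).
rewrite (RintegralD measurableT (gi' _) (gr' _)).
rewrite !(RintegralZl _ measurableT gr) !(RintegralZl _ measurableT gi).
by case: c.
Qed.

Lemma cintegralD g h : cintegrable mu g -> cintegrable mu h ->
  cintegral (fun x => g x + h x) = cintegral g + cintegral h.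
Proof.
move=> [gr gi] [hr hi]; rewrite /cintegral.
under eq_Rintegral do rewrite ReD.
under [X in _ +i* X]eq_Rintegral do rewrite ImD.
by rewrite !RintegralD.
Qed.

Lemma cintegral_sum (I : Type) (r : seq I) (g : I -> R -> R[i]) :
  (forall i, cintegrable mu (g i)) ->
  cintegral (fun x => \sum_(i <- r) g i x) = \sum_(i <- r) cintegral (g i).
Proof.
move=> ig; elim: r => [|i r IH].
  under [X in cintegral X]eq_fun do rewrite big_nil.
  by rewrite big_nil /cintegral !Rintegral_cst//= mul0r.
under [X in cintegral X]eq_fun do rewrite big_cons.
by rewrite big_cons cintegralD// ?IH//; exact: cintegrable_sum.
Qed.

(** Positive and negative parts are translated separately, so measurability suffices. *)
Lemma integral_shift (b : R) (f : R -> \bar R) : measurable_fun setT f ->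
  (\int[mu]_x f (x + b)%R = \int[mu]_x f x)%E.
Proof.
move=> mf; have E (f' : R -> \bar R) : measurable_fun setT f' ->
    (forall x, 0 <= f' x)%E -> (\int[mu]_x f' (x + b)%R = \int[mu]_x f' x)%E.
  move=> mf' f0; have := ge0_integral_affine 1 b f' (oner_neq0 _) mf' f0.
  rewrite normr1 invr1 mul1e => <-.
  by apply: eq_integral => x _; rewrite mul1r.
rewrite [LHS]integralE [RHS]integralE; congr (_ - _)%E.
  rewrite -[RHS](E (f^\+)%E (measurable_funepos mf) (funepos_ge0 f)).
  by apply: eq_integral => x _; rewrite unlock.
rewrite -[RHS](E (f^\-)%E (measurable_funeneg mf) (funeneg_ge0 f)).
by apply: eq_integral => x _; rewrite unlock.
Qed.

Lemma cintegral_shift (b : R) g : cmeasurable g ->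
  cintegral (fun x => g (x + b)) = cintegral g.
Proof.
move=> [/measurable_EFinP gr /measurable_EFinP gi].
rewrite /cintegral /Rintegral.
by rewrite (integral_shift b _ gr) (integral_shift b _ gi).
Qed.

Lemma cintegrable_shift (b : R) g : cintegrable mu g ->
  cintegrable mu (fun x => g (x + b)).
Proof.
have E (f : R -> \bar R) : mu.-integrable setT f ->
    mu.-integrable setT (fun x => f (x + b)).
  move=> /integrableP[mf fi]; apply/integrableP; split.
    apply: measurableT_comp mf _.
    by apply: measurable_funD => //; exact: measurable_id.
  rewrite (integral_shift b (fun x => `|f x|)%E)//.
  exact: measurableT_comp.
by move=> [gr gi]; split; [exact: E gr|exact: E gi].
Qed.

(* Stated for predicates on [R] rather than on its measurable copy, for which
   the instance search of [filterS] fails. *)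
Lemma ae_imp (P Q : R -> Prop) : (forall x, P x -> Q x) ->
  {ae mu, forall x, P x} -> {ae mu, forall x, Q x}.
Proof.
move=> PQ [B [mB B0 PB]]; exists B; split => // x /= nQ.
by apply: PB => /PQ.
Qed.

Lemma ae_and (P Q : R -> Prop) :
  {ae mu, forall x, P x} -> {ae mu, forall x, Q x} ->
  {ae mu, forall x, P x /\ Q x}.
Proof. exact: (@filterI _ (almost_everywhere mu) _ P Q). Qed.

Lemma ae_shift (b : R) (P : R -> Prop) : {ae mu, forall t, P t} ->
  {ae mu, forall t, P (t + b)}.
Proof.
move=> [B [mB B0 PB]]; exists ((fun x => x + b) @^-1` B); split.
- rewrite -[X in measurable X]setTI.
  have : measurable_fun setT
      ((fun x => x + b) : measurableTypeR R -> measurableTypeR R).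
    by apply: measurable_funD => //; exact: measurable_id.
  exact.
- have := @scale_pushforward_affine_gt0 R 1 b B ltr01 mB.
  rewrite mul1e /pushforward B0.
  by under [X in X @^-1` _]eq_fun do rewrite mul1r.
- by move=> t /= /PB.
Qed.

Lemma ae_eq_cintegral g h : cmeasurable g -> cmeasurable h ->
  {ae mu, forall x, g x = h x} -> cintegral g = cintegral h.
Proof.
move=> [/measurable_EFinP gr /measurable_EFinP gi].
move=> [/measurable_EFinP hr /measurable_EFinP hi] gh.
have E (p : R[i] -> R) :
    {ae mu, forall x, setT x -> (p (g x))%:E = (p (h x))%:E}.
  by apply: ae_imp gh => x ->.
rewrite /cintegral /Rintegral; congr (fine _ +i* fine _).
  by apply: ae_eq_integral => //; exact: (E (@complex.Re R)).
by apply: ae_eq_integral => //; exact: (E (@complex.Im R)).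
Qed.

End complex_integral.
(** * The Radon transform *)

Section radon_transform.
Context {R : realType} (theta : R).
Local Notation plane := (measurableTypeR R * measurableTypeR R)%type.
Local Notation mu := (@lebesgue_measure R).
Local Notation mu2 := (@lebesgue_measure R \x @lebesgue_measure R)%E.
Implicit Types f : plane -> R[i].

Lemma cmeasurable_section f t : cmeasurable f ->
  @cmeasurable R _ (measurableTypeR R) (fun s => f (rot theta (t, s))).
Proof.
move=> [mr mi]; split.
  apply: (measurableT_comp (f := (fun x => complex.Re (f x)) \o rot theta)).
    exact: measurableT_comp mr (measurable_rot theta).
  exact: pair1_measurable.
apply: (measurableT_comp (f := (fun x => complex.Im (f x)) \o rot theta)).
  exact: measurableT_comp mi (measurable_rot theta).
exact: pair1_measurable.
Qed.

Lemma ae_eq_radon f g : cmeasurable f -> cmeasurable g ->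
  {ae leb2, forall x, f x = g x} ->
  {ae mu, forall t, radon theta f t = radon theta g t}.
Proof.
move=> mf mg /(ae_rot theta); apply: filterS => t fg.
apply: ae_eq_cintegral => //; exact: cmeasurable_section.
Qed.

Lemma ae_cintegrable_section f : cintegrable mu2 f ->
  {ae mu, forall t, cintegrable mu (fun s => f (rot theta (t, s)))}.
Proof.
move=> [ir ii].
have := ae_integrable1 (integrable_rot theta _ ir).
have := ae_integrable1 (integrable_rot theta _ ii).
by apply: filterS2 => t hi hr; split.
Qed.

(** The component of [k] along the direction of integration. Together with [pdot] it gives the
    coordinates of [k] in the rotated frame. *)
Definition pperp (k : int * int) : R :=
  k.2%:~R * cos theta - k.1%:~R * sin theta.

Lemma rot_shift (k : int * int) (t s : R) :
  shift2 (rot theta (t, s)) k =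
  rot theta (t - pdot theta k, s - pperp k).
Proof.
rewrite /shift2 /rot /pdot /pperp /=.
have := cos2Dsin2 theta; set c := cos theta; set d := sin theta => cd.
have E (a b : R) : (t * c - s * d - a, t * d + s * c - b) =
    ((t - (a * c + b * d)) * c - (s - (b * c - a * d)) * d,
     (t - (a * c + b * d)) * d + (s - (b * c - a * d)) * c).
  congr (_, _).
    (* The shift is multiplied by 1, written as the sum of the squares of cosine and sine; what
       remains is a polynomial identity. *)
    rewrite -[X in _ - X = _]mulr1 -cd; ring.
  rewrite -[X in _ - X = _]mulr1 -cd; ring.
exact: E.
Qed.

(** Only the component of [k] across the lines moves [t]; the component along them is absorbed by
    the translation invariance of the line integral. *)
Lemma radon_shift f (k : int * int) t : cmeasurable f ->
  radon theta (fun x => f (shift2 x k)) t = radon theta f (t - pdot theta k).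
Proof.
move=> mf; rewrite -[RHS](cintegral_shift (- pperp k)); last first.
  exact: cmeasurable_section.
by congr cintegral; apply/funext => s; exact: (congr1 f (rot_shift k t s)).
Qed.

Lemma cintegrable_section_shift f (k : int * int) t :
  cintegrable mu (fun s => f (rot theta (t - pdot theta k, s))) ->
  cintegrable mu (fun s => f (shift2 (rot theta (t, s)) k)).
Proof.
move=> /(cintegrable_shift (- pperp k)).
by under eq_fun do rewrite -rot_shift.
Qed.

(** Linearity of the line integral requires integrable sections. By Fubini these are available for
    almost every [t], simultaneously for the finitely many shifts. *)
Lemma radon_sum (I : finType) f (d : I -> R[i]) (k : I -> int * int) :
  cintegrable mu2 f ->
  {ae mu, forall t, radon theta (fun x => \sum_i d i * f (shift2 x (k i))) t =
    \sum_i d i * radon theta f (t - pdot theta (k i))}.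
Proof.
move=> intf.
have : {ae mu, forall t, forall i : I,
    cintegrable mu (fun s => f (rot theta (t - pdot theta (k i), s)))}.
  apply: filter_forall => i.
  exact: (ae_shift (- pdot theta (k i)) _ (ae_cintegrable_section _ intf)).
apply: ae_imp => t it.
rewrite /radon cintegral_sum; last first.
  by move=> i; apply: cintegrableZ; exact: cintegrable_section_shift.
apply: eq_bigr => i _.
rewrite cintegralZ; last exact: cintegrable_section_shift.
congr (_ * _); apply: radon_shift.
exact: cintegrable_measurable intf.
Qed.

End radon_transform.

(** * Essential supports and integrability on bounded boxes *)

Section support.
Context {R : realType}.
Local Notation plane := (measurableTypeR R * measurableTypeR R)%type.
Local Notation mu := (@lebesgue_measure R).
Local Notation mu2 := (@lebesgue_measure R \x @lebesgue_measure R)%E.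

Lemma ae2_imp (P Q : R * R -> Prop) : (forall x, P x -> Q x) ->
  {ae leb2, forall x, P x} -> {ae leb2, forall x, Q x}.
Proof.
move=> PQ [B [mB B0 PB]]; exists B; split => // x /= nQ.
by apply: PB => /PQ.
Qed.

Lemma ae2_and (P Q : R * R -> Prop) :
  {ae leb2, forall x, P x} -> {ae leb2, forall x, Q x} ->
  {ae leb2, forall x, P x /\ Q x}.
Proof. exact: (@filterI _ (almost_everywhere leb2) _ P Q). Qed.

Lemma rat_itv_nbhs (x e : R) : 0 < e ->
  exists p q : rat,
    [/\ x - e < ratr p, ratr p < x, x < ratr q & ratr q < x + e].
Proof.
move=> e0.
have [|p] := @rat_in_itvoo R (x - e) x; first by rewrite ltrBlDr ltrDl.
have [|q] := @rat_in_itvoo R x (x + e); first by rewrite ltrDl.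
by rewrite !in_itv/= => /andP[? ?] /andP[? ?]; exists p, q.
Qed.

(* Countably many rational boxes cover the complement of the support. *)
Lemma ae_eq0_off_supp (f : R * R -> R[i]) :
  {ae leb2, forall x, ~ supp f x -> f x = 0}.
Proof.
pose rect (q : rat * rat * rat * rat) : set (R * R) :=
  [set x | (ratr q.1.1.1 < x.1 < ratr q.1.1.2) /\
             (ratr q.1.2 < x.2 < ratr q.2)].
(* Rational boxes are enumerated by their codes. The premise inside makes the claim vacuous for
   boxes on which [f] is not almost everywhere zero, so a countable intersection over all codes is
   possible. *)
have : {ae leb2, forall y, forall n q, unpickle n = Some q ->
    {ae leb2, forall y, rect q y -> f y = 0} -> rect q y -> f y = 0}.
  apply: (ae_foralln (mu := mu2)) => n.
  case: (unpickle n) => [q|]; last exact: aeW.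
  have [aeq|naeq] := pselect {ae leb2, forall y, rect q y -> f y = 0}.
    by apply: ae2_imp aeq => y fy _ [<-] _.
  by apply: aeW => y _ [<-] /naeq.
apply: ae2_imp => y H.
move=> /existsNP[U] /not_implyP[oU] /not_implyP[Uy] /contrapT aeU.
have /nbhs_ballP[e /= e0 yeU] : nbhs y U by exact: open_nbhs_nbhs.
have [p1 [q1 [p11 p12 q11 q12]]] := rat_itv_nbhs y.1 _ e0.
have [p2 [q2 [p21 p22 q21 q22]]] := rat_itv_nbhs y.2 _ e0.
pose q := (p1, q1, p2, q2).
apply: (H (pickle q) q); first exact: pickleK.
- apply: ae2_imp aeU => z Uz [/= /andP[z1 z2] /andP[z3 z4]]; apply: Uz.
  by apply: yeU; split; rewrite /ball/= ltr_distlC; apply/andP; split; lra.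
- by split; apply/andP.
Qed.

Lemma sqnorm_ge_Re (z : R[i]) : `|complex.Re z| <= 1 + sqnorm z.
Proof.
rewrite /sqnorm ler_norml; apply/andP; split; nra.
Qed.

Lemma sqnorm_ge_Im (z : R[i]) : `|complex.Im z| <= 1 + sqnorm z.
Proof.
rewrite /sqnorm ler_norml; apply/andP; split; nra.
Qed.

(** Each component of [f] is dominated by the indicator of the box plus [sqnorm f]: the box has
    finite measure, and off it [f] vanishes almost everywhere. *)
Lemma L2_cintegrable (f : R * R -> R[i]) (a b : R * R) : L2 f ->
  {ae leb2, forall x, ~ box a b x -> f x = 0} -> cintegrable mu2 f.
Proof.
move=> [mr mi ioo] f0.
have mB : measurable (box a b : set plane).
  by apply: measurableX; exact: measurable_itv.
have msq : measurable_fun [set: plane] (fun x => (sqnorm (f x))%:E).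
  apply/measurable_EFinP; apply: measurable_funD; exact: measurable_funX.
have mI : measurable_fun [set: plane] (fun x => (\1_(box a b) x : R)%:E).
  exact/measurable_EFinP/measurable_indic.
have key (p : R[i] -> R) : measurable_fun [set: plane] (fun x => p (f x)) ->
    p 0 = 0 -> (forall z, `|p z| <= 1 + sqnorm z) ->
    mu2.-integrable setT (fun x => (p (f x))%:E).
  move=> mp p0 ple; apply/integrableP; split; first exact/measurable_EFinP.
  apply: (@le_lt_trans _ _
    (\int[mu2]_x ((\1_(box a b) x : R)%:E + (sqnorm (f x))%:E))%E).
    apply: ae_ge0_le_integral => //.
    - by apply: measurableT_comp => //; exact/measurable_EFinP.
    - by move=> x _; rewrite adde_ge0// lee_fin// addr_ge0// sqr_ge0.
    - exact: emeasurable_funD.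
    - apply: ae2_imp f0 => x f0 _; rewrite -EFinD abse_EFin lee_fin.
      rewrite indicE; case: (boolP (x \in box a b)) => [_|]; first exact: ple.
      rewrite notin_setE => /f0 ->; rewrite p0 normr0 add0r.
      by rewrite addr_ge0// sqr_ge0.
  rewrite ge0_integralD//; last first.
    by move=> x _; rewrite lee_fin addr_ge0// sqr_ge0.
  rewrite lte_add_pinfty// integral_indic// setIT.
  have fin (x y : R) : mu `[x, y]%classic \is a fin_num.
    by rewrite lebesgue_measure_itv/=; case: ifP.
  suff : (mu2 (box a b) < +oo)%E by [].
  have -> : (mu2 (box a b) = mu `[a.1, b.1]%classic * mu `[a.2, b.2]%classic)%E.
    by apply: product_measure1E; exact: measurable_itv.
  by rewrite -(fineK (fin a.1 b.1)) -(fineK (fin a.2 b.2)) -EFinM ltry.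
split; apply: key => //.
- exact: sqnorm_ge_Re.
- exact: sqnorm_ge_Im.
Qed.

End support.
(** * Cosine transforms and Fejer kernels *)

Section trig_transform.
Context {R : realType}.
Local Notation mu := (@lebesgue_measure R).
Local Notation mu2 := (@lebesgue_measure R \x @lebesgue_measure R)%E.
Implicit Types h w p : R -> R.

Lemma integrableM_le1 h p : mu.-integrable setT (fun x => (h x)%:E) ->
  measurable_fun setT p -> (forall x, `|p x| <= 1) ->
  mu.-integrable setT (fun x => (h x * p x)%:E).
Proof.
move=> ih mp p1; apply: (le_integrable _ _ _ ih) => //.
  apply/measurable_EFinP; apply: measurable_funM => //.
  by move/measurable_int/measurable_EFinP : ih.
by move=> x _; rewrite !abse_EFin lee_fin normrM ler_piMr.
Qed.

Lemma continuous_compM p (a : R) : continuous p ->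
  continuous (fun x : R => p (x * a)).
Proof.
move=> cp x; apply: continuous_comp; last exact: cp.
exact: mulrr_continuous.
Qed.

Lemma integrable_trig h p (xi : R) : mu.-integrable setT (fun x => (h x)%:E) ->
  continuous p -> (forall x, `|p x| <= 1) ->
  mu.-integrable setT (fun x => (h x * p (x * xi))%:E).
Proof.
move=> ih cp p1; apply: (integrableM_le1 h (fun x => p (x * xi))) => //.
by apply: continuous_measurable_fun; exact: continuous_compM.
Qed.

(** Dominated convergence, with [|h|] as the dominating function. *)
Lemma continuous_trig_transform h p : mu.-integrable setT (fun x => (h x)%:E) ->
  continuous p -> (forall x, `|p x| <= 1) ->
  continuous (fun xi : R => \int[mu]_x (h x * p (x * xi))).
Proof.
move=> ih cp p1 xi.
apply: (@continuity_under_integral R _ _ mu (fun xi x => h x * p (x * xi))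
  setT measurableT (xi - 1) (xi + 1) _ _ (fun x => `|h x|)).
- by move=> a _; exact: integrable_trig.
- apply: aeW => y _ a _ /=; apply: cvgMr.
  apply: (@continuous_comp _ _ _ (fun x => y * x) p); last exact: cp.
  exact: mulrl_continuous.
- by move/integrable_abse : ih.
- by move=> a _; apply: aeW => y _; rewrite normrM ler_piMr.
- by rewrite inE/= in_itv/= ltrDl ltrBlDr ltrDl ltr01.
Qed.

(** Fubini applies because the bounded factor [p] leaves the integrand dominated by the integrable
    product of [h] and [w]. *)
Lemma trig_transform_swap h w p : mu.-integrable setT (fun x => (h x)%:E) ->
  mu.-integrable setT (fun x => (w x)%:E) ->
  continuous p -> (forall x, `|p x| <= 1) ->
  \int[mu]_xi (w xi * \int[mu]_x (h x * p (x * xi))) =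
  \int[mu]_x (h x * \int[mu]_xi (w xi * p (x * xi))).
Proof.
move=> ih iw cp p1.
have mh : measurable_fun setT h by move/measurable_int/measurable_EFinP : ih.
have mw : measurable_fun setT w by move/measurable_int/measurable_EFinP : iw.
have mp : measurable_fun setT p by exact: continuous_measurable_fun.
pose G (z : measurableTypeR R * measurableTypeR R) := h z.1 * w z.2.
pose F (z : measurableTypeR R * measurableTypeR R) := G z * p (z.1 * z.2).
have mG : measurable_fun setT G.
  apply: measurable_funM; first exact: measurableT_comp mh measurable_fst.
  exact: measurableT_comp mw measurable_snd.
have mF : measurable_fun setT F.
  apply: measurable_funM => //; apply: measurableT_comp mp _.
  exact: measurable_funM.
have iG : mu2.-integrable setT (EFin \o G).
  apply/integrable12ltyP; first exact/measurable_EFinP.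
  have -> : (\int[mu]_x \int[mu]_y `|(EFin \o G) (x, y)| =
     \int[mu]_x (`|(h x)%:E| * \int[mu]_y `|(w y)%:E|))%E.
    apply: eq_integral => x _; rewrite -ge0_integralZl//.
      by apply: eq_integral => y _; rewrite -abseM -EFinM.
    by apply: measurableT_comp => //; exact/measurable_EFinP.
  move/integrableP : ih => [_ ih]; move/integrableP : iw => [_ iw].
  rewrite ge0_integralZr//.
  - apply: lte_mul_pinfty => //; first exact: integral_ge0.
    by rewrite ge0_fin_numE//; exact: integral_ge0.
  - by apply: measurableT_comp => //; exact/measurable_EFinP.
  - exact: integral_ge0.
have iF : mu2.-integrable setT (EFin \o F).
  apply: (le_integrable _ _ _ iG) => //; first exact/measurable_EFinP.
  by move=> z _; rewrite /= lee_fin normrM ler_piMr.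
have := Fubini iF.
have -> : (\int[mu]_x \int[mu]_y (EFin \o F) (x, y) =
    \int[mu]_x (h x * \int[mu]_xi (w xi * p (x * xi)))%:E)%E.
  apply: eq_integral => x _.
  have iwp : mu.-integrable setT (fun y => (w y * p (x * y))%:E).
    under eq_fun do rewrite (mulrC x).
    exact: integrable_trig.
  rewrite EFinM /Rintegral fineK; last exact: integrable_fin_num.
  rewrite -integralZl//; apply: eq_integral => y _.
  by rewrite /F /G/= -EFinM mulrA.
have -> : (\int[mu]_y \int[mu]_x (EFin \o F) (x, y) =
    \int[mu]_xi (w xi * \int[mu]_x (h x * p (x * xi)))%:E)%E.
  apply: eq_integral => y _.
  have ihp : mu.-integrable setT (fun x => (h x * p (x * y))%:E).
    exact: integrable_trig.
  rewrite EFinM /Rintegral fineK; last exact: integrable_fin_num.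
  rewrite -integralZl//; apply: eq_integral => x _.
  by rewrite /F /G/= -EFinM mulrA (mulrC (w y)).
by move=> E; rewrite /Rintegral E.
Qed.

End trig_transform.

(** * Fejer kernels and their bounds *)

Section fejer_kernel.
Context {R : realType}.
Local Notation mu := (@lebesgue_measure R).

Lemma Rintegral_FTC (f F : R -> R) (a b : R) : a < b -> continuous f ->
  (forall x : R, is_derive x 1 F (f x)) ->
  \int[mu]_(x in `[a, b]) f x = F b - F a.
Proof.
move=> ab cf dF.
have cF : continuous F.
  by move=> x; apply/differentiable_continuous/derivable1_diffP; case: (dF x).
rewrite /Rintegral (@continuous_FTC2 _ f F)//.
- exact: continuous_subspaceT.
- split=> [x _||]; first by case: (dF x).
  + by apply: cvg_at_right_filter; exact: cF.
  + by apply: cvg_at_left_filter; exact: cF.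
- by move=> x _; rewrite derive1E; case: (dF x).
Qed.

Lemma ler_norm_sin (x : R) : `|sin x| <= `|x|.
Proof.
wlog x0 : x / 0 <= x => [H|].
  have [/H//|x0] := leP 0 x.
  by rewrite -normrN -sinN -(normrN x); apply: H; rewrite oppr_ge0 ltW.
have [|c _] := @MVT_segment R sin cos 0 x x0 (fun x _ => is_derive_sin x).
  exact/continuous_subspaceT/continuous_sin.
rewrite sin0 !subr0 => ->; rewrite normrM ler_piMl//; exact: cos_max.
Qed.

Lemma onem_cos_le (x : R) : 1 - cos x <= x ^+ 2 / 2.
Proof.
have -> : x = x / 2 *+ 2 by rewrite -mulr_natr -mulrA mulVf ?mulr1.
rewrite cos_mulr2n cos2sin2; set y := x / 2.
have : sin y ^+ 2 <= y ^+ 2.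
  rewrite -real_normK ?num_real// -[leRHS]real_normK ?num_real//.
  by rewrite lerXn2r ?nnegrE// ler_norm_sin.
rewrite -mulr_natr; nra.
Qed.

(** The Fejer kernel, up to normalization. At [x = 0] the division convention gives 0 instead of the
    limit [T / 2], hence the condition [x != 0] in the integral formula below. *)
Definition fejer (T x : R) : R := (1 - cos (x * T)) / (T * x ^+ 2).

Lemma fejer_ge0 (T x : R) : 0 < T -> 0 <= fejer T x.
Proof.
move=> T0; apply: divr_ge0; first by rewrite subr_ge0 cos_le1.
by rewrite mulr_ge0 ?sqr_ge0// ltW.
Qed.

Lemma fejer_le_tail (T x d : R) : 0 < T -> 0 < d -> d <= `|x| ->
  fejer T x <= 2 / (T * d ^+ 2).
Proof.
move=> T0 d0 dx.
have x2 : d ^+ 2 <= x ^+ 2.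
  by rewrite -[leRHS]real_normK ?num_real// lerXn2r// ?nnegrE// ltW.
have d2 : 0 < d ^+ 2 by rewrite exprn_gt0.
apply: ler_pM.
- by rewrite subr_ge0 cos_le1.
- by rewrite invr_ge0 mulr_ge0 ?sqr_ge0// ltW.
- by have := cos_geN1 (x * T); lra.
- rewrite lef_pV2 ?posrE; first by rewrite ler_wpM2l// ltW.
  + by rewrite mulr_gt0// (lt_le_trans d2).
  + by rewrite mulr_gt0.
Qed.

(** With [y = x * T], the bounds [1 - cos y <= y ^+ 2 / 2] and [1 - cos y <= 2] give [(1 - cos y) *
    (1 + y ^+ 2) <= 5 / 2 * y ^+ 2]. The Poisson kernel on the right has an elementary primitive,
    which makes the mass of the Fejer kernel easy to bound. *)
Lemma fejer_le_poisson (T x : R) : 0 < T -> x != 0 ->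
  fejer T x <= 5 / 2 * (T * (1 + (T * x) ^+ 2)^-1).
Proof.
move=> T0 x0; set y := x * T.
have y0 : 0 < y ^+ 2 by rewrite exprn_even_gt0//= mulf_neq0// gt_eqF.
have -> : fejer T x = T * ((1 - cos y) / y ^+ 2).
  rewrite /fejer -/y /y; field; rewrite x0 gt_eqF//.
rewrite (mulrC T x) -/y [leRHS]mulrCA ler_pM2l//.
rewrite ler_pdivrMr// mulrAC ler_pdivlMr; last by rewrite addr_gt0.
have := onem_cos_le y; have := cos_geN1 y; nra.
Qed.

Lemma fejer_integral (T x : R) : 0 < T -> x != 0 ->
  \int[mu]_(xi in `[0, T]) ((1 - xi / T) * cos (x * xi)) = fejer T x.
Proof.
move=> T0 x0; have T0' : T != 0 by rewrite gt_eqF.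
(* A primitive of the integrand, found by integration by parts. *)
pose F (xi : R) : R :=
  (1 - xi / T) * (sin (x * xi) / x) - cos (x * xi) / (T * x ^+ 2).
have -> : fejer T x = F T - F 0.
  rewrite /F /fejer mulr0 sin0 cos0 divff// subrr mul0r sub0r.
  by rewrite !mul0r mulr0 sub0r opprK mulrBl addrC.
apply: Rintegral_FTC => //.
- move=> xi; apply: cvgM.
    by apply: cvgB; [exact: cvg_cst|exact: mulrr_continuous].
  apply: continuous_comp; [exact: mulrl_continuous|exact: continuous_cos].
- move=> xi; rewrite /F.
  have dm : is_derive xi 1 (fun xi : R => x * xi) x.
    by apply: is_derive_eq; rewrite /GRing.scale/=; ring.
  have ds : is_derive xi 1 (fun xi => sin (x * xi)) (cos (x * xi) * x).
    exact: (is_derive1_comp (f := sin) (g := fun xi => x * xi)).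
  have dc : is_derive xi 1 (fun xi => cos (x * xi)) (- sin (x * xi) * x).
    exact: (is_derive1_comp (f := cos) (g := fun xi => x * xi)).
  apply: is_derive_eq; rewrite /GRing.scale/=.
  by field; rewrite x0 T0'.
Qed.

(** The integrand is the derivative of [atan (T * x)], whose values lie between [- pi / 2] and
    [pi / 2]; the bound is therefore uniform in [T] and [d]. *)
Lemma Rintegral_poisson_le (T d : R) : 0 < T -> 0 < d ->
  \int[mu]_(x in `[- d, d]) (T * (1 + (T * x) ^+ 2)^-1) <= pi.
Proof.
move=> T0 d0.
rewrite (_ : Rintegral _ _ _ = atan (T * d) - atan (T * - d)).
  by have := atan_ltpi2 (T * d); have := atan_gtNpi2 (T * - d); lra.
apply: (Rintegral_FTC _ (fun x => atan (T * x))).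
- by lra.
- move=> x; apply: cvgM; first exact: cvg_cst.
  apply: (@continuous_comp _ _ _ ( *%R T) (fun y : R => (1 + y ^+ 2)^-1)).
    exact: mulrl_continuous.
  exact: continuous_oneDsqrV.
- move=> x; rewrite mulrC.
  have dm : is_derive x 1 (fun x : R => T * x) T.
    by apply: is_derive_eq; rewrite /GRing.scale/=; ring.
  exact: (is_derive1_comp (f := atan) (g := fun x => T * x)).
Qed.

End fejer_kernel.

(** * Cesaro means of cosine transforms *)

Section cos_transform.
Context {R : realType}.
Local Notation mu := (@lebesgue_measure R).
Implicit Types h p : R -> R.

(** Integrating against this weight averages the partial integrals over [[0, s]] for [s] in
    [[0, T]]. *)
Definition cesaro_weight (T : R) : R -> R := (fun xi => 1 - xi / T) \_ `[0, T].

Lemma cesaro_weight_ge0 (T xi : R) : 0 < T -> 0 <= cesaro_weight T xi.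
Proof.
move=> T0; rewrite /cesaro_weight patchE; case: ifPn => //.
by rewrite inE/= in_itv/= => /andP[_ xT]; rewrite subr_ge0 ler_pdivrMr// mul1r.
Qed.

Lemma integrable_restrict_continuous h (a b : R) : continuous h ->
  mu.-integrable setT (fun x => ((h \_ `[a, b]) x)%:E).
Proof.
move=> ch.
have : mu.-integrable `[a, b] (EFin \o h).
  apply: continuous_compact_integrable; first exact: segment_compact.
  exact: continuous_subspaceT.
have mI : measurable (`[a, b]%classic : set (measurableTypeR R)).
  exact: measurable_itv.
by move=> /(integrable_mkcond _ mI); rewrite restrict_EFin.
Qed.

Lemma continuous_weight (T : R) : continuous (fun xi : R => 1 - xi / T).
Proof. by move=> x; apply: cvgB; [exact: cvg_cst|exact: mulrr_continuous]. Qed.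

Lemma integrable_cesaro_weight (T : R) :
  mu.-integrable setT (fun xi => (cesaro_weight T xi)%:E).
Proof. exact/integrable_restrict_continuous/continuous_weight. Qed.

Lemma Rintegral_cesaro_weight (T x : R) : 0 < T -> x != 0 ->
  \int[mu]_xi (cesaro_weight T xi * cos (x * xi)) = fejer T x.
Proof.
move=> T0 x0; rewrite -(fejer_integral _ _ T0 x0) [RHS]Rintegral_mkcond.
apply: eq_Rintegral => xi _; rewrite /cesaro_weight !patchE.
by case: ifPn => //; rewrite mul0r.
Qed.

(** After Fubini the Cesaro mean is the integral of [h] against a Fejer kernel. Near 0 the function
    [h] is small and the kernel has bounded mass; away from 0 the kernel is of order [1 / T] and [h]
    is integrable. Each region contributes at most [e / 2]. *)
Lemma cesaro_cos_transform_small h (e : R) :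
  mu.-integrable setT (fun x => (h x)%:E) ->
  {for 0, continuous h} -> h 0 = 0 -> 0 < e ->
  exists2 T0 : R, 0 < T0 & forall T, T0 <= T ->
    \int[mu]_xi (cesaro_weight T xi * \int[mu]_x (h x * cos (x * xi))) <= e.
Proof.
move=> ih ch h0 e0.
(* Chosen so that [eta] times the mass bound [5 / 2 * pi] equals [e / 2]. *)
pose eta := e / (5 * pi).
have pi0 := pi_gt0 R.
have eta0 : 0 < eta by rewrite divr_gt0// mulr_gt0.
have [d d0 hd] : exists2 d : R, 0 < d & forall x, `|x| <= d -> `|h x| <= eta.
  move/cvgrPdist_le : ch => /(_ _ eta0) /nbhs_ballP[d /= d0 hd].
  exists (d / 2); first by rewrite divr_gt0.
  move=> x xd; have := hd x; rewrite h0 sub0r normrN; apply.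
  by rewrite /ball/= sub0r normrN (le_lt_trans xd)// gtr_pMr// invf_lt1 ?ltr1n.
pose N := \int[mu]_x `|h x|.
have N0 : 0 <= N by apply: Rintegral_ge0.
(* From here on the tail bound [2 / (T * d ^+ 2) * N] is at most [e / 2]; the summand 1 keeps the
   threshold positive even if [N] is 0. *)
exists (1 + 4 * N / (d ^+ 2 * e)).
  by rewrite ltr_pwDl// divr_ge0// mulr_ge0// ?sqr_ge0// ltW.
move=> T TT0.
have T0 : 0 < T.
  apply: lt_le_trans TT0; rewrite ltr_pwDl// divr_ge0// mulr_ge0// ?sqr_ge0//.
  exact: ltW.
rewrite (trig_transform_swap h _ cos ih (integrable_cesaro_weight T)
  (@continuous_cos R) (@cos_max R)).
pose P (x : R) := T * (1 + (T * x) ^+ 2)^-1.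
have cP : continuous P.
  move=> x; apply: cvgM; first exact: cvg_cst.
  apply: (@continuous_comp _ _ _ ( *%R T) (fun y : R => (1 + y ^+ 2)^-1)).
    exact: mulrl_continuous.
  exact: continuous_oneDsqrV.
have P0 x : 0 <= P x.
  by rewrite mulr_ge0 ?(ltW T0)// invr_ge0 addr_ge0// sqr_ge0.
(* The dominating function: its first term controls the product on [[- d, d]], its second term the
   tails. *)
pose B (x : R) :=
  eta * (5 / 2) * (P \_ `[- d, d]) x + 2 / (T * d ^+ 2) * `|h x|.
have iB1 : mu.-integrable setT
    (fun x => (eta * (5 / 2) * (P \_ `[- d, d]) x)%:E).
  under eq_fun do rewrite EFinM.
  by apply: integrableZl => //; exact: integrable_restrict_continuous.
have ihn : mu.-integrable setT (fun x => `|h x|%:E).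
  by move/integrable_abse : ih.
have iB2 : mu.-integrable setT (fun x => (2 / (T * d ^+ 2) * `|h x|)%:E).
  by under eq_fun do rewrite EFinM; apply: integrableZl.
have iB : mu.-integrable setT (fun x => (B x)%:E).
  by under eq_fun do rewrite EFinD; apply: integrableD.
pose K (x : R) := \int[mu]_xi (cesaro_weight T xi * cos (x * xi)).
have mK : measurable_fun setT K.
  apply: continuous_measurable_fun.
  rewrite (_ : K = fun x => \int[mu]_xi (cesaro_weight T xi * cos (xi * x))).
    exact: (@continuous_trig_transform R _ cos (integrable_cesaro_weight T)
      (@continuous_cos R) (@cos_max R)).
  by apply/funext => x; apply: eq_Rintegral => xi _; rewrite (mulrC x).
have PI0 x : 0 <= (P \_ `[- d, d]) x by rewrite patchE; case: ifP.
have Td0 : 0 <= 2 / (T * d ^+ 2).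
  by rewrite divr_ge0// mulr_ge0 ?sqr_ge0 ?(ltW T0).
have hKB x : `|h x * K x| <= B x.
  (* At 0 the closed formula for the kernel fails, but there [h] vanishes. *)
  have [->|x0] := eqVneq x 0.
    rewrite h0 mul0r normr0; apply: addr_ge0; apply: mulr_ge0 => //.
    by rewrite mulr_ge0// ltW.
  rewrite /K Rintegral_cesaro_weight// normrM.
  rewrite (ger0_norm (fejer_ge0 _ _ T0)) /B patchE.
  case: ifPn => [|]; rewrite ?notin_setE ?inE/= in_itv/= -ler_norml => xd.
    rewrite (@le_trans _ _ (eta * (5 / 2 * P x)))//.
      apply: ler_pM => //; [exact: fejer_ge0|exact: hd|].
      exact: fejer_le_poisson.
    rewrite mulrA lerDl mulr_ge0// divr_ge0// mulr_ge0 ?sqr_ge0//; exact: ltW.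
  rewrite mulr0 add0r mulrC ler_wpM2r// fejer_le_tail//.
  by rewrite ltW// ltNge; apply/negP.
have ihK : mu.-integrable setT (fun x => (h x * K x)%:E).
  apply: (le_integrable _ _ _ iB) => //.
    apply/measurable_EFinP; apply: measurable_funM => //.
    by move/measurable_int/measurable_EFinP : ih.
  move=> x _; rewrite !abse_EFin lee_fin (le_trans (hKB x))//; exact: ler_norm.
apply: (@le_trans _ _ (\int[mu]_x B x)).
  apply: le_Rintegral => //.
  by move=> x _; rewrite (le_trans _ (hKB x))// ler_norm.
rewrite (RintegralD measurableT iB1 iB2) (RintegralZl _ measurableT ihn).
rewrite RintegralZl//; last exact: integrable_restrict_continuous.
rewrite -Rintegral_mkcond -/N.
have := Rintegral_poisson_le T d T0 d0.
rewrite -/P; set I := Rintegral _ _ _ => Ipi.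
have : eta * (5 / 2) * I <= e / 2.
  rewrite (@le_trans _ _ (eta * (5 / 2) * pi))//.
    by apply: ler_wpM2l => //; apply: mulr_ge0 => //; exact: ltW.
  suff -> : eta * (5 / 2) * pi = e / 2 by [].
  have E (q : R) : q != 0 -> e / (5 * q) * (5 / 2) * q = e / 2.
    by move=> ?; field.
  exact/E/lt0r_neq0.
have : 2 / (T * d ^+ 2) * N <= e / 2.
  have d2 : 0 < d ^+ 2 by rewrite exprn_gt0.
  rewrite mulrAC ler_pdivrMr ?mulr_gt0//.
  have : 4 * N / (d ^+ 2 * e) <= T by lra.
  rewrite ler_pdivrMr ?mulr_gt0//; nra.
lra.
Qed.

(* A nonnegative cosine transform that is positive somewhere has Cesaro means
   bounded away from [0]; they would tend to [0] since [h] vanishes at [0]. *)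
Lemma cos_transform_eq0 h :
  mu.-integrable setT (fun x => (h x)%:E) ->
  {for 0, continuous h} -> h 0 = 0 ->
  (forall xi, 0 <= \int[mu]_x (h x * cos (x * xi))) ->
  forall xi, \int[mu]_x (h x * cos (x * xi)) = 0.
Proof.
move=> ih ch h0; set C := fun xi => \int[mu]_x (h x * cos (x * xi)) => C0.
have cC : continuous C.
  by apply: continuous_trig_transform => //;
    [exact: continuous_cos|exact: cos_max].
suff Cge0 (xi : R) : 0 <= xi -> C xi = 0.
  move=> xi; have [/Cge0//|xi0] := leP 0 xi.
  rewrite -[RHS](Cge0 (- xi)) ?oppr_ge0 ?ltW//.
  by apply: eq_Rintegral => x _; rewrite mulrN cosN.
move=> xi0; apply/eqP; rewrite eq_le C0 andbT leNgt; apply/negP => Cxi.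
have [r r0 Cr] : exists2 r : R, 0 < r &
    forall x, x \in `[xi, xi + r] -> C xi / 2 <= C x.
  have C2 : 0 < C xi / 2 by rewrite divr_gt0.
  have /cvgrPdist_le /(_ _ C2) /nbhs_ballP[r /= r0 hr] := cC xi.
  exists (r / 2); first by rewrite divr_gt0.
  move=> x; rewrite in_itv/= => /andP[x1 x2].
  have : `|C xi - C x| <= C xi / 2.
    by apply: hr; rewrite /ball/= distrC ger0_norm ?subr_ge0//; lra.
  by rewrite ler_distlC => /andP[+ _]; lra.
(* On [[xi, xi + r]] the transform is at least [C xi / 2]. The choice of [T] below, at least
   [2 * (xi + r)], makes the weight at least 1/2 there. The Cesaro mean is then at least [c * r],
   against the upper bound [c * r / 2]. *)
pose c := C xi / 2 / 2.
have c0 : 0 < c by rewrite !divr_gt0.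
have [T0 T00 small] := @cesaro_cos_transform_small h (c * r / 2) ih ch h0
  ltac:(by rewrite divr_gt0// mulr_gt0).
pose T := T0 + 2 * (xi + r).
have T0' : 0 < T by rewrite addr_gt0// mulr_gt0// ltr_wpDl.
have /small : T0 <= T by rewrite lerDl mulr_ge0// addr_ge0// ltW.
apply/negP; rewrite -ltNge -/C.
have iwC : mu.-integrable setT (fun y => (cesaro_weight T y * C y)%:E).
  have := @integrable_restrict_continuous (fun y => (1 - y / T) * C y) 0 T.
  rewrite (_ : (fun y : R => (1 - y / T) * C y) \_ `[0, T] =
    fun y => cesaro_weight T y * C y); last first.
    apply/funext => y; rewrite /cesaro_weight !patchE.
    by case: ifP; rewrite ?mul0r.
  by apply => y; apply: cvgM; [exact: continuous_weight|exact: cC].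
apply: (@lt_le_trans _ _ (\int[mu]_y (cst c \_ `[xi, xi + r]) y)).
  rewrite -Rintegral_mkcond Rintegral_cst//= lebesgue_measure_itv/= lte_fin.
  by rewrite ltrDl r0 /= addrAC subrr add0r; nra.
apply: le_Rintegral => //.
  by apply: integrable_restrict_continuous => ?; exact: cvg_cst.
move=> y _; rewrite [leLHS]patchE; case: ifPn => [|_]; last first.
  by rewrite mulr_ge0// cesaro_weight_ge0.
rewrite inE => yI; have := Cr _ yI.
move: yI; rewrite /= in_itv/= => /andP[y1 y2] Cy.
rewrite /c mulrC; apply: ler_pM => //; first by rewrite ltW// divr_gt0.
rewrite /cesaro_weight patchE mem_set/=; last first.
  by rewrite in_itv/= (le_trans xi0)//= (le_trans y2)// /T; lra.
have : y / T <= 2^-1.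
  by rewrite ler_pdivrMr// /T; lra.
lra.
Qed.

End cos_transform.
(** * Exponential sums and Toeplitz systems *)

Section exponential_sums.
Context {R : realType}.
Implicit Types x y : R.

Lemma expiD x y : expi (x + y) = expi x * expi y.
Proof.
rewrite /expi sinD cosD; apply/eqP.
by rewrite eq_complex/= eqxx/= addrC.
Qed.

Lemma expi0 : expi 0 = 1 :> R[i].
Proof. by rewrite /expi sin0 cos0. Qed.

Lemma expiMn x n : expi (x *+ n) = expi x ^+ n.
Proof.
by elim: n => [|n IH]; rewrite ?mulr0n ?expi0// mulrS expiD IH exprS.
Qed.

Lemma conj_expi x : ((expi x)^*)%C = expi (- x).
Proof. by rewrite /expi cosN sinN. Qed.

Lemma expi_neq0 x : expi x != 0.
Proof.
apply/negP => /eqP e0; have := expiD x (- x).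
by rewrite subrr expi0 e0 mul0r => /eqP; rewrite oner_eq0.
Qed.

(** Equal exponentials force [sin (x - y) = 0], while the sine is positive strictly between 0 and
    [pi]. *)
Lemma expi_inj_lt_pi x y : `|x - y| < pi -> expi x = expi y -> x = y.
Proof.
move=> xy [c s].
have s0 : sin (x - y) = 0 by rewrite sinB c s mulrC subrr.
apply/eqP; rewrite -subr_eq0; apply/negPn/negP => xy0.
have : 0 < sin `|x - y| by rewrite sin_gt0_pi// normr_gt0 xy0.
by case: (ger0P (x - y)) => _; rewrite ?sinN s0 ?oppr0 ltxx.
Qed.

(* On an arithmetic progression of small step the frequencies become distinct
   nodes of a Vandermonde matrix. *)
Lemma exp_sum_eq0 (n : nat) (y : 'I_n -> R) (c : 'I_n -> R[i]) (a r : R) :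
  injective y -> 0 < r ->
  (forall x, `|x - a| < r -> \sum_l c l * expi (- (y l * x)) = 0) ->
  forall l, c l = 0.
Proof.
move=> y_inj r0 P0.
pose D := 1 + \sum_(j < n) \sum_(l < n) `|y j - y l|.
have D1 : 1 <= D by rewrite lerDl; do 2 (apply: sumr_ge0 => ? _).
have D0 : 0 < D by exact: lt_le_trans D1.
have yD j l : `|y j - y l| <= D.
  apply: (@le_trans _ _ (\sum_(l < n) `|y j - y l|)).
    by rewrite (bigD1 l)//= lerDl; apply: sumr_ge0.
  rewrite /D ler_wpDl// [leRHS](bigD1 j)//= lerDl.
  by do 2 (apply: sumr_ge0 => ? _).
(* The first bound keeps the points [a + d *+ i], for [i < n], within [r] of [a]. The second makes
   the phases [y j * d] differ by at most 1, which is less than [pi], so that the nodes are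
   distinct. *)
pose d := Num.min (r / n.+1%:R) (D^-1).
have d0 : 0 < d by rewrite lt_min divr_gt0//= invr_gt0.
pose z : 'rV[R[i]]_n := \row_j expi (- (y j * d)).
have z_inj j l : z 0 j = z 0 l -> j = l.
  rewrite !mxE => /expi_inj_lt_pi H; apply: y_inj.
  apply: (mulIf (lt0r_neq0 d0)); apply: oppr_inj; apply: H.
  rewrite -opprD normrN -mulrBl normrM (gtr0_norm d0).
  apply: (@le_lt_trans _ _ (D * D^-1)).
    by apply: ler_pM => //; [exact: ltW|rewrite ge_min lexx orbT].
  by rewrite divff ?lt0r_neq0// (lt_le_trans _ (pi_ge2 R))// ltr1n.
pose V := Vandermonde n z.
have V0 : \det V != 0.
  rewrite det_Vandermonde; apply/prodf_neq0 => i _; apply/prodf_neq0 => j ij.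
  by rewrite subr_eq0; apply: contraTneq ij => /z_inj ->; rewrite ltnn.
(* The phases at the base point [a] are absorbed into the unknowns, which leaves pure powers of the
   nodes as coefficients. *)
pose w : 'cV[R[i]]_n := \col_j (c j * expi (- (y j * a))).
have Vw : V *m w = 0.
  apply/matrixP => i k; rewrite !mxE.
  rewrite -[RHS](P0 (a + d *+ i)); last first.
    rewrite addrAC subrr add0r normrMn (gtr0_norm d0) -mulr_natr.
    apply: (@le_lt_trans _ _ (r / n.+1%:R * i%:R)).
      by rewrite ler_wpM2r// ge_min lexx.
    rewrite mulrAC ltr_pdivrMr// ltr_pM2l// ltr_nat ltnS ltnW//.
  apply: eq_bigr => j _; rewrite !mxE mulrCA; congr (_ * _).
  by rewrite -expiMn -expiD mulrDr opprD addrC mulrnAr mulNrn.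
have : w = 0.
  have Vu : V \in unitmx by rewrite unitmxE unitfE.
  by rewrite -[w](mulKmx Vu) Vw mulmx0.
move=> /matrixP w0 l; have := w0 l 0; rewrite !mxE => /eqP.
by rewrite mulf_eq0 (negbTE (expi_neq0 _)) orbF => /eqP.
Qed.

End exponential_sums.

(** * Fourier transforms with nonnegative real part *)

Section fourier_positivity.
Context {R : realType}.
Local Notation mu := (@lebesgue_measure R).
Implicit Types g : R -> R[i].

Lemma Re_mul_expi (z : R[i]) (x : R) : complex.Re (z * expi (- x)) =
  complex.Re z * cos x + complex.Im z * sin x.
Proof. by rewrite ReM/= cosN sinN mulrN opprK. Qed.

Lemma Im_mul_expi (z : R[i]) (x : R) : complex.Im (z * expi (- x)) =
  complex.Im z * cos x - complex.Re z * sin x.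
Proof. by rewrite ImM/= cosN sinN mulrN addrC. Qed.

Lemma cintegrable_mul_expi g (xi : R) : cintegrable mu g ->
  cintegrable mu (fun x => g x * expi (- (x * xi))).
Proof.
move=> [gr gi].
have grc := integrable_trig _ _ xi gr (@continuous_cos R) (@cos_max R).
have grs := integrable_trig _ _ xi gr (@continuous_sin R) (@sin_max R).
have gic := integrable_trig _ _ xi gi (@continuous_cos R) (@cos_max R).
have gis := integrable_trig _ _ xi gi (@continuous_sin R) (@sin_max R).
split.
  by under eq_fun do rewrite Re_mul_expi EFinD; exact: integrableD.
by under eq_fun do rewrite Im_mul_expi EFinB; exact: integrableB.
Qed.

Lemma Re_fourier g (xi : R) : cintegrable mu g -> complex.Re (fourier g xi) =
  \int[mu]_x (complex.Re (g x) * cos (x * xi)) +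
  \int[mu]_x (complex.Im (g x) * sin (x * xi)).
Proof.
move=> [gr gi]; rewrite /fourier /=.
under eq_Rintegral do rewrite Re_mul_expi.
apply: RintegralD => //.
  exact: (integrable_trig _ _ xi gr (@continuous_cos R) (@cos_max R)).
exact: (integrable_trig _ _ xi gi (@continuous_sin R) (@sin_max R)).
Qed.

Lemma continuous_Re_fourier g : cintegrable mu g ->
  continuous (fun xi => complex.Re (fourier g xi)).
Proof.
move=> ig; rewrite (_ : (fun xi => _) = (fun xi : R =>
  \int[mu]_x (complex.Re (g x) * cos (x * xi)) +
  \int[mu]_x (complex.Im (g x) * sin (x * xi)))); last first.
  by apply/funext => xi; exact: Re_fourier.
case: ig => gr gi x; apply: cvgD.
  exact: (continuous_trig_transform _ _ gr (@continuous_cos R) (@cos_max R)).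
exact: (continuous_trig_transform _ _ gi (@continuous_sin R) (@sin_max R)).
Qed.

Lemma fourierZ (c : R[i]) g (xi : R) : cintegrable mu g ->
  fourier (fun x => c * g x) xi = c * fourier g xi.
Proof.
move=> ig; rewrite /fourier -cintegralZ; last exact: cintegrable_mul_expi.
by congr cintegral; apply/funext => x; rewrite mulrA.
Qed.

Lemma fourier_sum (I : Type) (r : seq I) (g : I -> R -> R[i]) (xi : R) :
  (forall i, cintegrable mu (g i)) ->
  fourier (fun x => \sum_(i <- r) g i x) xi = \sum_(i <- r) fourier (g i) xi.
Proof.
move=> ig; rewrite /fourier -cintegral_sum.
  by congr cintegral; apply/funext => x; rewrite mulr_suml.
by move=> i; exact: cintegrable_mul_expi.
Qed.

Lemma fourier_shift g (b xi : R) : cintegrable mu g ->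
  fourier (fun x => g (x + b)) xi = expi (b * xi) * fourier g xi.
Proof.
move=> ig; rewrite /fourier -cintegralZ; last exact: cintegrable_mul_expi.
rewrite -[RHS](cintegral_shift b); last first.
  apply: (cintegrable_measurable mu).
  by apply: cintegrableZ; exact: cintegrable_mul_expi.
congr cintegral; apply/funext => x; rewrite mulrCA; congr (_ * _).
by rewrite -expiD mulrDl opprD addrCA subrr addr0.
Qed.

(** Adding the values at [xi] and [- xi] cancels the odd sine part and leaves twice the cosine
    transform of the real part of [g]. This is nonnegative, hence zero, and two nonnegative summands
    with sum zero both vanish. *)
Lemma Re_fourier_eq0 g : cintegrable mu g ->
  {for 0, continuous (fun x => complex.Re (g x))} -> complex.Re (g 0) = 0 ->
  (forall xi, 0 <= complex.Re (fourier g xi)) ->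
  forall xi, complex.Re (fourier g xi) = 0.
Proof.
move=> ig cg g0 pos xi.
have W x : complex.Re (fourier g x) + complex.Re (fourier g (- x)) =
    (\int[mu]_y (complex.Re (g y) * cos (y * x))) *+ 2.
  rewrite !Re_fourier//.
  under [X in _ + (X + _)]eq_Rintegral do rewrite mulrN cosN.
  under [X in _ + (_ + X)]eq_Rintegral do rewrite mulrN sinN mulrN -mulN1r.
  rewrite RintegralZl//.
    by rewrite mulN1r addrACA subrr addr0.
  exact: (integrable_trig _ _ x ig.2 (@continuous_sin R) (@sin_max R)).
have C0 : \int[mu]_y (complex.Re (g y) * cos (y * xi)) = 0.
  apply: (cos_transform_eq0 (fun y => complex.Re (g y))) => //.
    exact: ig.1.
  move=> x; rewrite -(pmulrn_lge0 _ (isT : (0 < 2)%N)) -W.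
  by rewrite addr_ge0.
have := W xi; rewrite C0 mul0rn => /eqP.
by rewrite paddr_eq0// => /andP[/eqP].
Qed.

Lemma mul_conj_sqnorm (z w : R[i]) :
  complex.Re ((z^*)%C * z * w) = sqnorm z * complex.Re w.
Proof. by case: z => a b; case: w => x y; rewrite /sqnorm /=; ring. Qed.

Lemma sqnorm_eq0 (z : R[i]) : sqnorm z == 0 -> z = 0.
Proof.
case: z => a b; rewrite /sqnorm /= paddr_eq0 ?sqr_ge0// !sqrf_eq0.
by move=> /andP[/eqP-> /eqP->].
Qed.

Lemma continuous_Re g : continuous (g : R -> R[i]^o) ->
  continuous (fun x => complex.Re (g x)).
Proof.
move=> cg x; apply/cvgrPdist_le => e e0.
have e0' : 0 < e%:C by rewrite ltcR.
move: (cg x) => /cvgrPdist_le /(_ _ e0'); apply: filterS => t.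
rewrite -lecR; apply: le_trans.
by rewrite (le_trans _ (normc_ge_Re _))// lecR; case: (g x) => ? ?; case: (g t).
Qed.

Lemma continuous_Im g : continuous (g : R -> R[i]^o) ->
  continuous (fun x => complex.Im (g x)).
Proof.
move=> cg; have := @continuous_Re (fun x => - 'i%C * g x).
rewrite (_ : (fun x => _) = (fun x => complex.Im (g x))); last first.
  by apply/funext => x; case: (g x) => a b /=; ring.
apply => x; apply: cvgMr; exact: cg.
Qed.

Lemma continuous_csum (I : Type) (r : seq I) (g : I -> R -> R[i]) :
  (forall i, continuous (g i : R -> R[i]^o)) ->
  continuous ((fun x => \sum_(i <- r) g i x) : R -> R[i]^o).
Proof.
move=> cg; elim: r => [|i r IH] x.
  by under eq_fun do rewrite big_nil; exact: cvg_cst.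
under eq_fun do rewrite big_cons.
by apply: cvgD; [exact: cg|exact: IH].
Qed.

Lemma continuous_cscale_shift (c : R[i]) (b : R) g :
  continuous (g : R -> R[i]^o) ->
  continuous ((fun x => c * g (x + b)) : R -> R[i]^o).
Proof.
move=> cg x; apply: cvgMr.
apply: (@continuous_comp _ _ _ (fun x : R => x + b) (g : R -> R[i]^o)).
  by apply: cvgD; [exact: cvg_id|exact: cvg_cst].
exact: cg.
Qed.

(** The linear system enters as the vanishing of its Hermitian form at [c], which is the value at 0
    of the auxiliary function [h]. *)
Lemma toeplitz_injective (n : nat) (y : 'I_n -> R) (c : 'I_n -> R[i]) g :
  injective y -> cintegrable mu g -> continuous (g : R -> R[i]^o) ->
  (forall xi, 0 <= complex.Re (fourier g xi)) ->
  (exists xi, complex.Re (fourier g xi) <> 0) ->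
  (forall j, \sum_l g (y j - y l) * c l = 0) -> forall l, c l = 0.
Proof.
move=> y_inj ig cg pos [xi0 nz] Ac.
pose P (xi : R) := \sum_l c l * expi (- (y l * xi)).
pose G j l (x : R) := (c j)^*%C * c l * g (x + (y j - y l)).
pose h (x : R) := \sum_j \sum_l G j l x.
have iG j l : cintegrable mu (G j l).
  exact/cintegrableZ/cintegrable_shift.
have ih : cintegrable mu h.
  by apply: cintegrable_sum => j; exact: cintegrable_sum.
(* Each shift by [y j - y l] becomes a phase, and the double sum of phases factors as the conjugate
   of [P xi] times [P xi]. *)
have hE xi :
    complex.Re (fourier h xi) = sqnorm (P xi) * complex.Re (fourier g xi).
  rewrite -mul_conj_sqnorm; congr complex.Re.
  rewrite fourier_sum; last by move=> j; exact: cintegrable_sum.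
  rewrite [((P xi)^*)%C]rmorph_sum/= !mulr_suml; apply: eq_bigr => j _.
  rewrite fourier_sum// -mulrA mulr_suml mulr_sumr; apply: eq_bigr => l _.
  rewrite fourierZ; last exact: cintegrable_shift.
  rewrite fourier_shift// [RHS]mulrA -!mulrA.
  have -> : ((c j * expi (- (y j * xi)))^*)%C = (c j)^*%C * expi (y j * xi).
    have := conj_expi (- (y j * xi)); rewrite opprK => <-; exact: rmorphM.
  rewrite mulrDl expiD mulNr.
  by rewrite !mulrA; congr (_ * _ * _); rewrite mulrAC.
have Re0 : forall xi, complex.Re (fourier h xi) = 0.
  apply: Re_fourier_eq0 => //.
  - apply: continuous_Re; apply: continuous_csum => j.
    by apply: continuous_csum => l; exact: continuous_cscale_shift.
  - rewrite /h big1// => j _.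
    under eq_bigr do rewrite /G add0r -mulrA (mulrC (c _)).
    by rewrite -mulr_sumr Ac mulr0.
  - by move=> xi; rewrite hE mulr_ge0// addr_ge0// sqr_ge0.
(* By continuity the real part stays nonzero around [xi0]; there the vanishing product forces [P] to
   be 0. *)
have [r r0 gr] : exists2 r : R, 0 < r & forall x, `|x - xi0| < r ->
    complex.Re (fourier g x) != 0.
  have v0 : 0 < `|complex.Re (fourier g xi0)| by rewrite normr_gt0; apply/eqP.
  have /cvgrPdist_lt /(_ _ v0) /nbhs_ballP[r /= r0 hr] :=
    continuous_Re_fourier _ ig xi0.
  exists r => // x xr; apply/negP => /eqP gx.
  have /hr : ball xi0 r x by rewrite /ball/= distrC.
  by rewrite gx subr0 ltxx.
apply: (exp_sum_eq0 _ y c xi0 r) => // x /gr gx.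
have := hE x; rewrite Re0 => /esym/eqP; rewrite mulf_eq0 (negbTE gx) orbF.
exact: sqnorm_eq0.
Qed.

End fourier_positivity.
(** * Samples of continuous representatives *)

Section continuous_representatives.
Context {R : realType}.
Local Notation plane := (measurableTypeR R * measurableTypeR R)%type.
Local Notation mu := (@lebesgue_measure R).
Local Notation mu2 := (@lebesgue_measure R \x @lebesgue_measure R)%E.
Implicit Types (g h F : R -> R[i]).

(** If the functions differ at a point, they differ on a ball around it, and a ball of positive
    radius is not null. *)
Lemma ae_eq_continuous g h : continuous (g : R -> R[i]^o) ->
  continuous (h : R -> R[i]^o) -> {ae mu, forall t, g t = h t} -> g = h.
Proof.
move=> cg ch [B [mB B0 ghB]]; apply/funext => x; apply/eqP.
rewrite -subr_eq0; apply/negPn/negP => nz.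
have cgh : ((fun t => g t - h t) : R -> R[i]^o) @ x --> ((g x - h x) : R[i]^o).
  by apply: cvgB; [exact: cg|exact: ch].
have : nbhs x [set t | g t - h t != 0] by exact: cvgr_neq0 cgh nz.
move=> /nbhs_ballP[r /= r0 gh].
have : (mu (ball x r) <= mu B)%E.
  apply: le_measure; rewrite ?inE//; first exact: measurable_ball.
  by move=> t /gh ght; apply: ghB => /= /eqP; rewrite -subr_eq0; apply/negP.
rewrite lebesgue_measure_ball ?(ltW r0)// B0 lee_fin => /le_lt_trans.
by move=> /(_ (r *+ 2)); rewrite pmulrn_lgt0// ltxx => /(_ r0).
Qed.

Lemma crepE F g : crep_of F g -> crep F = g.
Proof.
move=> Fg; apply: xget_unique => // h Fh.
apply: ae_eq_continuous; [exact: Fh.1|exact: Fg.1|].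
have := ae_and _ _ Fh.2 Fg.2; apply: ae_imp => t [<- <-//].
Qed.

Lemma cmeasurable_continuous g : continuous (g : R -> R[i]^o) ->
  @cmeasurable R _ (measurableTypeR R) g.
Proof.
move=> cg; split; apply: continuous_measurable_fun.
  exact: continuous_Re.
exact: continuous_Im.
Qed.

Lemma ae_eq_cintegrable F g : cintegrable mu F ->
  @cmeasurable R _ (measurableTypeR R) g ->
  {ae mu, forall t, F t = g t} -> cintegrable mu g.
Proof.
move=> [Fr Fi] [gr gi] Fg.
have E (p : R[i] -> R) : mu.-integrable setT (fun x => (p (F x))%:E) ->
    measurable_fun setT (fun x : measurableTypeR R => p (g x)) ->
    mu.-integrable setT (fun x => (p (g x))%:E).
  move=> /integrableP[mF Foo] mg; apply/integrableP; split.
    exact/measurable_EFinP.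
  rewrite -(@ge0_ae_eq_integral _ _ _ mu setT (fun x => `|(p (F x))%:E|)%E)//.
  - exact: measurableT_comp.
  - by apply: measurableT_comp => //; exact/measurable_EFinP.
  - by apply: ae_imp Fg => t ->.
by split; exact: E.
Qed.

Lemma cintegrable_radon (theta : R) (f : plane -> R[i]) : cintegrable mu2 f ->
  cintegrable mu (radon theta f).
Proof.
move=> [ir ii].
have E (p : R[i] -> R) : mu2.-integrable setT (EFin \o (fun x => p (f x))) ->
    mu.-integrable setT (fun t => (\int[mu]_s p (f (rot theta (t, s))))%:E).
  move=> ip; have ipr := integrable_rot theta _ ip.
  have := integrable_fubini_F ipr; apply: le_integrable => //.
    apply/measurable_EFinP; apply: measurableT_comp.
      exact: fine_measurable.
    exact: (measurable_fubini_F ipr).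
  (* Where a section integral is infinite, its real-valued version is 0 by convention, so the
     domination persists. *)
  move=> t _; rewrite /Rintegral /fubini_F /=.
  by case: (\int[mu]_s _)%E => [r| |] //=; rewrite normr0 leey.
by split; [exact: (E (@complex.Re R))|exact: (E (@complex.Im R))].
Qed.

Lemma measurable_shift2 (k : int * int) :
  measurable_fun setT ((fun x => shift2 x k) : plane -> plane).
Proof.
by apply/measurable_fun_pairP; split; apply: measurable_funB.
Qed.

(** The combination of translates of [g] is continuous and agrees almost everywhere with the Radon
    transform of [f]; uniqueness of the continuous representative turns this into an equality at
    every point. *)
Lemma radon_sample_sum (theta : R) (n : nat) (phi f : R * R -> R[i]) g
    (d : 'I_n -> R[i]) (k : 'I_n -> int * int) :
  cintegrable mu2 phi -> crep_of (radon theta phi) g ->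
  @cmeasurable R _ plane f ->
  aeq2 f (fun x => \sum_i d i * phi (shift2 x (k i))) ->
  radon_sample theta f =
    fun t => \sum_i d i * g (t - pdot theta (k i)).
Proof.
move=> iphi [cg phig] mf aef; apply: crepE; split.
  by apply: continuous_csum => i; exact: continuous_cscale_shift.
have mphi : @cmeasurable R _ plane phi by exact: (cintegrable_measurable mu2).
have msum : @cmeasurable R _ plane (fun x => \sum_i d i * phi (shift2 x (k i))).
  apply: cmeasurable_sum => i; apply: cmeasurableZ.
  split; [have := mphi.1|have := mphi.2] => mp;
  exact: (measurableT_comp mp (measurable_shift2 (k i))).
have H1 := ae_eq_radon theta _ _ mf msum aef.
have H2 := radon_sum theta 'I_n phi d k iphi.
have H3 : {ae mu, forall t, forall i,
    radon theta phi (t - pdot theta (k i)) = g (t - pdot theta (k i))}.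
  apply: filter_forall => i; exact: (ae_shift (- pdot theta (k i)) _ phig).
have := ae_and _ _ H1 (ae_and _ _ H2 H3); apply: ae_imp => t [-> [-> gE]].
by apply: eq_bigr => i _; rewrite gE.
Qed.

Lemma fsbig_range (n : nat) (k : 'I_n -> int * int) (F : int * int -> R[i]) :
  injective k -> \sum_(i \in range k) F i = \sum_(j < n) F (k j).
Proof.
move=> k_inj; rewrite fsbig_image; last by move=> i j _ _; exact: k_inj.
rewrite [RHS]fsbig_seq ?index_enum_uniq//.
by apply: eq_fsbigl; apply/seteqP; split => i //= _; exact: mem_index_enum.
Qed.

End continuous_representatives.

(** * Sign normalization and the invertibility theorem *)

Lemma exists_positive_rotation (R : realType) (g : R -> R[i]) (u v : R -> R) :
  (forall xi, g xi = u xi +i* v xi) ->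
  ((exists xi, u xi <> 0) /\ sign_unchanged u) \/
  ((exists xi, v xi <> 0) /\ sign_unchanged v) ->
  exists2 w : R[i], forall xi, 0 <= complex.Re (w * g xi) &
    exists xi, complex.Re (w * g xi) <> 0.
Proof.
move=> gE; have oppr_neq0 (x : R) : x <> 0 -> - x <> 0.
  by move=> /eqP x0; apply/eqP; rewrite oppr_eq0.
move=> [] [[xi nz] [ge0|le0]].
- exists 1; first by move=> x; rewrite mul1r gE; exact: ge0.
  by exists xi; rewrite mul1r gE.
- have E x : complex.Re (- 1 * g x) = - u x by rewrite mulN1r gE.
  exists (-1); first by move=> x; rewrite E oppr_ge0.
  by exists xi; rewrite E; exact: oppr_neq0.
- have E x : complex.Re (- 'i%C * g x) = v x.
    by rewrite gE /=; ring.
  exists (- 'i%C); first by move=> x; rewrite E.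
  by exists xi; rewrite E.
- have E x : complex.Re ('i%C * g x) = - v x.
    by rewrite gE /=; ring.
  exists 'i%C; first by move=> x; rewrite E oppr_ge0.
  by exists xi; rewrite E; exact: oppr_neq0.
Qed.

Theorem theorem5p1 (R : realType) (phi : R * R -> R[i]) (N M a b : R * R)
  (theta : R) (n : nat) (k : 'I_n -> int * int)
  (phi_L2 : L2 phi)
  (phi_supp : supp phi `<=` box N M)
  (phi_indep : translates_independent phi)
  (phi_radon : radon_continuous theta phi)
  (k_inj : injective k)
  (k_enum : range k = index_set N M a b)
  (u v : R -> R)
  (uv_def : forall xi, fourier (radon theta phi) xi = u xi +i* v xi)
  (cond_i_or_ii : ((exists xi, u xi <> 0) /\ sign_unchanged u) \/
                  ((exists xi, v xi <> 0) /\ sign_unchanged v))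
  (cond_iii : (1 < n)%N ->
     forall l m : 'I_n, l <> m -> pdot theta (k l) <> pdot theta (k m))
  (f : R * R -> R[i])
  (f_target : target phi N M a b f) :
  sample_matrix theta phi k \in unitmx /\
  determined_uniquely theta phi (index_set N M a b)
    [set pdot theta (k j) | j in [set: 'I_n]] f.
Proof.
have phi0 : {ae leb2, forall x, ~ box N M x -> phi x = 0}.
  apply: ae2_imp (ae_eq0_off_supp phi) => x phi0 nbox.
  by apply: phi0 => /phi_supp.
have iphi := L2_cintegrable phi N M phi_L2 phi0.
have [g phig] := phi_radon; have [cg phig_ae] := phig.
have ig := ae_eq_cintegrable _ _ (cintegrable_radon theta phi iphi)
  (cmeasurable_continuous _ cg) phig_ae.
have gE xi : fourier g xi = u xi +i* v xi.
  rewrite -uv_def; apply: ae_eq_cintegral.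
  - apply: (cintegrable_measurable lebesgue_measure).
    exact: cintegrable_mul_expi.
  - apply: (cintegrable_measurable lebesgue_measure).
    by apply: cintegrable_mul_expi; exact: cintegrable_radon.
  - by apply: ae_imp phig_ae => t ->.
have y_inj : injective (pdot theta \o k).
  move=> i j /= ij; apply: contrapT => nij.
  (* Condition (iii) speaks only of more than one index; with at most one, any two indices
     coincide. *)
  have [n1|n1] := leqP n 1; last exact: cond_iii ij.
  apply: nij; apply: val_inj => /=.
  by case: n n1 i j {ij k k_inj k_enum cond_iii} =>
    [|[|]]// _ [[|?] ?] [[|?] ?].
have AE j l : sample_matrix theta phi k j l =
    g (pdot theta (k j) - pdot theta (k l)).
  by rewrite mxE /radon_sample (crepE _ _ phig).
have A_inj (c : 'I_n -> R[i]) :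
    (forall j, \sum_l g (pdot theta (k j) - pdot theta (k l)) * c l = 0) ->
    forall l, c l = 0.
  have [w pos nz] := exists_positive_rotation _ _ u v gE cond_i_or_ii.
  move=> Ac; apply: (toeplitz_injective _ (pdot theta \o k) c
    (fun x => w * g x) y_inj).
  - exact: cintegrableZ.
  - by move=> x; apply: cvgMr; exact: cg.
  - by move=> xi; rewrite fourierZ.
  - by case: nz => xi nz; exists xi; rewrite fourierZ.
  - by move=> j; under eq_bigr do rewrite -mulrA; rewrite -mulr_sumr Ac mulr0.
split.
  (* [det0P] provides a left null vector; passing to the transpose makes it a right null vector of
     the sample matrix. *)
  rewrite -unitmx_tr unitmxE unitfE; apply/negP => /det0P[c c0].
  move=> /matrixP cA; move/eqP : c0; apply; apply/rowP => l.
  rewrite [RHS]mxE; apply: (A_inj (c 0)) => j.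
  transitivity ((c *m (sample_matrix theta phi k)^T) 0 j); last first.
    by rewrite cA mxE.
  by rewrite mxE; apply: eq_bigr => i _; rewrite [in RHS]mxE AE mulrC.
move=> h [h_L2 [d hd]] hf; case: f_target => _ _ [f_L2 [c fc]].
have sumE (e : int * int -> R[i]) x :
    \sum_(i \in index_set N M a b) e i * phi (shift2 x i) =
    \sum_(j < n) e (k j) * phi (shift2 x (k j)).
  by rewrite -k_enum (fsbig_range _ k (fun i => e i * phi (shift2 x i)) k_inj).
have sampleE f' e : L2 f' ->
    aeq2 f' (fun x => \sum_(i \in index_set N M a b) e i * phi (shift2 x i)) ->
    radon_sample theta f' =
      fun t => \sum_(j < n) e (k j) * g (t - pdot theta (k j)).
  move=> [mr mi _] fe.
  apply: (radon_sample_sum theta n phi f' g (e \o k) k) => //.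
  by apply: ae2_imp fe => x ->; exact: sumE.
(* Equal samples at the points [pdot theta (k j)] say that the sample matrix annihilates the
   difference of the coefficient vectors. *)
have dc j : d (k j) = c (k j).
  apply/eqP; rewrite -subr_eq0; apply/eqP.
  apply: (A_inj (fun j => d (k j) - c (k j))) => {}j.
  have := hf (pdot theta (k j)).
  rewrite (sampleE _ _ h_L2 hd) (sampleE _ _ f_L2 fc).
  move=> /(_ (ex_intro2 _ _ j I erefl)) /eqP.
  rewrite -subr_eq0 -sumrB => /eqP hf0.
  rewrite -[RHS]hf0.
  by apply: eq_bigr => l _; rewrite mulrC mulrBl.
have := ae2_and _ _ hd fc; apply: ae2_imp => x [-> ->].
by rewrite !sumE; apply: eq_bigr => j _; rewrite dc.
Qed.
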